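(* Let $TF$ be the closed linear span in $V_2^0$ of $\{g_s : s\in 2^{<\mathbb{N}}\}$, where $((g_s),(I_s,J_s))_{s\in 2^{<\mathbb{N}}}$ is a tree family of trapezoids. Then the set $\mathcal{M}^c_{TF^{**}}=\{\mu_f: f\in TF^{**}\cap C[0,1]\}$ is a non-separable subset of $\mathcal{M}[0,1]$. Therefore the space $S^2$ is isomorphic to a subspace of $TF$.
   Context: For $f:[0,1]\to\mathbb{R}$ and a finite set $\mathcal{P}=\{t_0<\dots<t_p\}\subseteq[0,1]$ with $p\ge 1$, let $v_2(f,\mathcal{P})=\big(\sum_{i=0}^{p-1}(f(t_{i+1})-f(t_i))^2\big)^{1/2}$ and $\|\mathcal{P}\|_{\max}=\max_i (t_{i+1}-t_i)$. $V_2$ is the Banach space of all $f:[0,1]\to\mathbb{R}$ with $f(0)=0$ and $\|f\|_{V_2}=\sup_{\mathcal{P}}v_2(f,\mathcal{P})<\infty$. $V_2^0$ is the closed subspace of those $f\in V_2$ with $\lim_{\delta\to0}\sup\{v_2(f,\mathcal{P}):\|\mathcal{P}\|_{\max}<\delta\}=0$ (the square absolutely continuous functions). $2^{<\mathbb{N}}$ is the dyadic tree of finite $0$-$1$ sequences (including the empty one) ordered by initial segment; $(s,0),(s,1)$ denote the immediate successors of $s$, i.e. the sequence $s$ followed by $0$ and by $1$ respectively; an antichain is a set of pairwise incomparable elements. A tree family of trapezoids consists of closed intervals $I_s,J_s\subseteq[0,1]$ and functions $g_s$, $s\in2^{<\mathbb{N}}$, such that $J_s$ is a nondegenerate interval contained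 in the interior of $I_s$, $g_s$ is the continuous function equal to $1$ on $J_s$, equal to $0$ outside $I_s$ and affine on each of the two components of $I_s\setminus J_s$, and $I_{(s,0)}$, $I_{(s,1)}$ are disjoint subintervals of $J_s$. (All spaces $TF$ obtained in this way are isomorphic to each other.) The bidual of $V_2^0$ is identified isometrically with $V_2$ (the weak$^*$ topology on bounded sets being pointwise convergence), and for a closed subspace $X\subseteq V_2^0$, $X^{**}$ is identified with the corresponding subspace of $V_2$ (the weak$^*$ closure of $X$), which consists exactly of the pointwise limits of bounded sequences in $X$. Measure $\mu_f$: for $f\in V_2$ and an interval $I\subseteq[0,1]$, let $\widetilde{\mu}_f(I)=\inf_{\delta>0}\sup\{v_2^2(f,\mathcal{P}):\mathcal{P}\subseteq I \text{ finite},\ \|\mathcal{P}\|_{\max}<\delta\}$. Then $\mu_f$ is the finite positive Borel measure on $[0,1]$ determined by $\mu_f[0,x]=\lim_{y\to x^+}\widetilde{\mu}_f[0,y]$ for $0\le x<1$ and $\mu_f[0,1]=\widetilde{\mu}_f[0,1]$. $\mathcal{M}[0,1]$ is the space of finite signed Borel measures on $[0,1]$ with norm $\|\mu\|=\sup\{|\mu(B)|: B \text{ Borel}\}$. $S^2$ is the completion of the space of finitely supported functions $x:2^{<\mathbb{N}}\to\mathbb{R}$ under $\|x\|_{S^2}=\sup\{(\sum_{s\in A}|x(s)|^2)^{1/2}: A \text{ an antichain of } 2^{<\mathbb{N}}\}$. *)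

(* Defs.v *)
(* MathComp-Analysis. *)
From HB Require Import structures.
From mathcomp Require Import all_boot all_order all_algebra.
From mathcomp Require Import all_classical all_reals all_analysis.

Set Implicit Arguments.
Unset Strict Implicit.
Unset Printing Implicit Defensive.

Import Order.TTheory GRing.Theory Num.Theory.
Import numFieldNormedType.Exports.

Local Open Scope classical_set_scope.
Local Open Scope ring_scope.

Section QuadraticVariation.
Context {R : realType}.

(* A finite set {t_0 < ... < t_p} (p >= 1) contained in I is encoded as the
   increasing sequence of its points.  The end points of I need not belong
   to it. *)
Definition partition_in (I : set R) (P : seq R) : Prop :=
  [/\ (1 < size P)%N, sorted <%R P & forall t, t \in P -> I t].

Definition mesh (P : seq R) : R :=
  \big[Num.max/0]_(i < (size P).-1) (P`_i.+1 - P`_i).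

Definition v2 (f : R -> R) (P : seq R) : R :=
  Num.sqrt (\sum_(i < (size P).-1) (f P`_i.+1 - f P`_i) ^+ 2).

Definition V2_norm (f : R -> R) : \bar R :=
  ereal_sup [set (v2 f P)%:E | P in partition_in `[0, 1]].

(* A function [0,1] -> R is encoded as the function R -> R extending it by 0,
   so that V2_norm is a norm (not only a seminorm) on V2. *)
Definition V2 : set (R -> R) :=
  [set f | [/\ forall t, ~ `[0, 1]%classic t -> f t = 0,
               f 0 = 0
             & (V2_norm f < +oo)%E]].

Definition V20 : set (R -> R) :=
  [set f | V2 f /\
    ereal_sup [set (v2 f P)%:E | P in
      [set P | partition_in `[0, 1] P /\ mesh P < delta]]
      @[delta --> 0^'+] --> 0%E].

Definition linear_span (I : Type) (g : I -> R -> R) : set (R -> R) :=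
  [set h | exists (s : seq I) (k : I -> R),
    h = (fun t => \sum_(i <- s) k i * g i t)].

Definition closed_span (I : Type) (g : I -> R -> R) : set (R -> R) :=
  [set f | V20 f /\ forall e : R, 0 < e ->
    exists2 h, linear_span g h & (V2_norm (fun t => f t - h t)%R < e%:E)%E].

(* X** for a closed subspace X of V20, as a subspace of V2 = V20**: the
   pointwise limits of the bounded sequences of X. *)
Definition bidual (X : set (R -> R)) : set (R -> R) :=
  [set f | V2 f /\ exists u : nat -> R -> R,
    [/\ forall n, X (u n),
        exists M : R, forall n, (V2_norm (u n) <= M%:E)%E
      & forall t : R, `[0, 1]%classic t -> u n t @[n --> \oo] --> f t]].

(* Only meaningful for nondegenerate intervals I: otherwise there is no
   partition in I, and the supremum is -oo. *)
Definition mu_tilde (f : R -> R) (I : set R) : \bar R :=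
  ereal_inf [set ereal_sup [set (v2 f P ^+ 2)%:E | P in
      [set P | partition_in I P /\ mesh P < delta]]
    | delta in [set delta | 0 < delta]].

Definition borel_charge : Type := {charge set (measurableTypeR R) -> \bar R}.

(* Finite signed Borel measures on [0,1] are encoded as the charges on the
   Borel sets of R that vanish outside [0,1]. *)
Definition M01 : set borel_charge :=
  [set nu | forall B : set (measurableTypeR R),
    measurable B -> B `&` `[0, 1] = set0 -> nu B = 0%E].

Definition M01_dist (nu rho : borel_charge) : \bar R :=
  ereal_sup [set `|nu B - rho B|%E | B in
    [set B : set (measurableTypeR R) | measurable B /\ B `<=` `[0, 1]]].

(* nu = mu_f *)
Definition is_mu (f : R -> R) (nu : borel_charge) : Prop :=
  [/\ M01 nu,
      forall B : set (measurableTypeR R), measurable B -> (0 <= nu B)%E,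
      forall x : R, 0 <= x < 1 ->
        mu_tilde f `[0, y] @[y --> x^'+] --> nu `[0, x]%classic
    & nu `[0, 1]%classic = mu_tilde f `[0, 1]].

Definition Mc (X : set (R -> R)) : set borel_charge :=
  [set nu | exists f, [/\ bidual X f, {within `[0, 1], continuous f}
    & is_mu f nu]].

Definition M01_separable (A : set borel_charge) : Prop :=
  exists D, [/\ countable D, D `<=` A
    & forall nu, A nu -> forall e : R, 0 < e ->
        exists2 rho, D rho & (M01_dist nu rho < e%:E)%E].

End QuadraticVariation.

Section DyadicTree.
Context {R : realType}.

(* The dyadic tree is seq bool ordered by prefix; the immediate successors of
   s are rcons s false and rcons s true. *)

(* I_s = [a s, b s] and J_s = [c s, d s].  g_s is taken on the whole line,
   which forces g_s = 0 at the end points of I_s even when these are 0 or 1. *)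
Definition tree_family_of_trapezoids (a b c d : seq bool -> R)
    (g : seq bool -> R -> R) : Prop :=
  forall s,
  [/\ [/\ 0 <= a s, b s <= 1 & [/\ a s < c s, c s < d s & d s < b s]],
      [/\ continuous (g s),
          forall t, `[c s, d s]%classic t -> g s t = 1,
          forall t, ~ `[a s, b s]%classic t -> g s t = 0,
          exists p q : R, forall t, `[a s, c s[%classic t -> g s t = p * t + q
        & exists p q : R, forall t, `]d s, b s]%classic t -> g s t = p * t + q],
      forall i, `[a (rcons s i), b (rcons s i)] `<=` `[c s, d s]
    & `[a (rcons s false), b (rcons s false)] `&`
      `[a (rcons s true), b (rcons s true)] = set0].

Definition antichain (A : set (seq bool)) : Prop :=
  forall s t, A s -> A t -> prefix s t -> s = t.

Definition S2_norm (x : seq bool -> R) : \bar R :=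
  ereal_sup [set sqrte (\esum_(s in A) (x s ^+ 2)%:E) | A in antichain].

Definition finitely_supported (x : seq bool -> R) : Prop :=
  finite_set [set s | x s != 0].

(* The completion of the finitely supported functions under S2_norm, realized
   as their closure in the space of the functions of finite S2_norm.  That
   space is complete: S2_norm dominates the supremum norm and is lower
   semicontinuous for pointwise convergence. *)
Definition S2 : set (seq bool -> R) :=
  [set x | forall e : R, 0 < e ->
    exists2 y, finitely_supported y &
      (S2_norm (fun s => x s - y s)%R < e%:E)%E].

(* The image of T is the subspace of X onto which T is an isomorphism. *)
Definition S2_isomorphic_to_subspace_of (X : set (R -> R)) : Prop :=
  exists T : (seq bool -> R) -> R -> R,
  [/\ forall x, S2 x -> X (T x),
      forall (k : R) x y, S2 x -> S2 y -> forall t,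
        T (fun s => k * x s + y s) t = k * T x t + T y t
    & exists m M : R, [/\ 0 < m, 0 < M & forall x, S2 x ->
        (m%:E * S2_norm x <= V2_norm (T x) <= M%:E * S2_norm x)%E]].

End DyadicTree.

(* Main.v *)
Require Import Defs.
From HB Require Import structures.
From mathcomp Require Import all_boot all_order all_algebra.
From mathcomp Require Import all_classical all_reals all_analysis.
From mathcomp Require Import ring lra.

Set Implicit Arguments.
Unset Strict Implicit.
Unset Printing Implicit Defensive.

Import Order.TTheory GRing.Theory Num.Theory.
Import numFieldNormedType.Exports.

Local Open Scope classical_set_scope.
Local Open Scope ring_scope.

(** A bump is a function that climbs from 0 to 1 in [K] equal steps along a chain
of nested trapezoids.  At every step there is a side branch on the left of the
chain and another one on its right; each of them carries two bumps of the next
level, one for each immediate successor in the dyadic tree.  So every bump has a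
label in the dyadic tree, and [s], of length [n], is represented by the function
[f s], the sum of all the bumps labelled [s] multiplied by an amplitude whose
square is the inverse of their number.  The embedding of [S2] sends [x] to the sum
of the functions [x s * f s].

The upper estimate [upper_estimate] rests on three facts about a partition [P].
The amplitudes decrease so fast that the levels are almost orthogonal
([almost_orthogonal]): the quadratic variation of the sum is controlled by the sum
over all bumps of the square of their coefficient times the energy that [P]
collects on them.
A bump yields energy only through large increments, and an increment over [L]
steps of the chain, which contributes at most [L / K], jumps over nearly [L] side
branches, whose bumps are then invisible to [P] ([phi_jump]).  Hence, if [A s]
denotes the proportion of the bumps labelled [s] that [P] meets, the energy
collected on [f s] is, up to a small error, at most a multiple of the difference
between [A s] and the larger of the values of [A] at the two successors of [s]
([missed_budget]).  Finally [A] decreases along the tree, so that its losses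
distribute a total mass of at most 1 among antichains, and the resulting average
of the sums of [x s ^ 2] over antichains is at most the square of the [S2] norm
([antichain_budget]).  The side branches have to lie on both sides of the chain:
if they were all on the left, a bump could be left in a single jump from its top
without missing anything, and the energies would add up along a branch.

The lower estimate is exact: between the foot and the top of a bump no other bump
varies ([phi_foot_top]), and bumps with incomparable labels are disjoint
([foot_top_disjoint]), so the [S2] norm of [x] is at most the norm of its image.

The indicator of an infinite branch [sigma] of the dyadic tree has quadratic sum
at most 1 over every antichain.  Hence its image, although the indicator is not in
[S2], is a continuous function in the bidual.  It keeps a definite quadratic
variation at arbitrarily small scales, because the bumps of a late level are
short except for few of them ([branch_fun_reaches]).  If [tau] leaves [sigma]
before level [n], then on the bumps of [sigma] at level [n] the function of [tau]
coincides with a finite sum of bumps, which is square absolutely continuous.  So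
the measure of [tau] vanishes where that of [sigma] has mass at least 1/2
([branch_measures_separated]), and there are uncountably many branches.

All this supposes that the successor labelled [false] lies on the left of the
other one; a relabelling of the tree ([orient]) ensures it. *)

(** * Quadratic variation along a list of points *)

Section QuadraticVariationOfLists.
Context {R : realType}.
Implicit Types (f g : R -> R) (P l : seq R) (x y z t : R).

Definition qv f P : R := \sum_(i < (size P).-1) (f P`_i.+1 - f P`_i) ^+ 2.

Lemma qv_ge0 f P : 0 <= qv f P.
Proof. by apply: sumr_ge0 => i _; exact: sqr_ge0. Qed.

Lemma sqr_v2 f P : v2 f P ^+ 2 = qv f P.
Proof. by rewrite /v2 sqr_sqrtr // qv_ge0. Qed.

Lemma v2_ge0 f P : 0 <= v2 f P. Proof. exact: sqrtr_ge0. Qed.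

Lemma v2_le f P c : 0 <= c -> (v2 f P <= c) = (qv f P <= c ^+ 2).
Proof. by move=> c0; rewrite -sqr_v2 ler_sqr // nnegrE ?v2_ge0. Qed.

Lemma qv1 f x : qv f [:: x] = 0.
Proof. by rewrite /qv big_ord0. Qed.

Lemma qv_cons2 f x y l : qv f (x :: y :: l) = (f y - f x) ^+ 2 + qv f (y :: l).
Proof. by rewrite /qv /= big_ord_recl. Qed.

Lemma mesh_ge0 P : 0 <= mesh P.
Proof. by rewrite /mesh; elim/big_rec: _ => // i u _ u0; rewrite le_max u0 orbT. Qed.

Lemma mesh1 x : mesh [:: x] = 0.
Proof. by rewrite /mesh big_ord0. Qed.

Lemma mesh_cons2 x y l : mesh (x :: y :: l) = Num.max (y - x) (mesh (y :: l)).
Proof. by rewrite /mesh /= big_ord_recl. Qed.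

Lemma qv_cat f x l1 l2 :
  qv f (x :: l1 ++ l2) = qv f (x :: l1) + qv f (last x l1 :: l2).
Proof.
elim: l1 x => [|y l1 IH] x /=; first by rewrite qv1 add0r.
by rewrite !qv_cons2 IH addrA.
Qed.

Lemma mesh_cat x l1 l2 :
  mesh (x :: l1 ++ l2) = Num.max (mesh (x :: l1)) (mesh (last x l1 :: l2)).
Proof.
elim: l1 x => [|y l1 IH] x /=.
  rewrite mesh1; case: l2 => [|z l2]; first by rewrite mesh1 maxxx.
  by apply/esym/max_idPr; exact: mesh_ge0.
by rewrite !mesh_cons2 IH maxA.
Qed.

Lemma qv_eq f g P : {in P, f =1 g} -> qv f P = qv g P.
Proof.
move=> fg; apply: eq_bigr => i _.
have iP : (i.+1 < size P)%N by case: P fg i => [|x P] _ [] //.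
by rewrite !fg // mem_nth // ltnW.
Qed.

Lemma qvD_le f g P :
  qv (fun t => f t + g t) P <= 2 * qv f P + 2 * qv g P.
Proof.
rewrite /qv !mulr_sumr -big_split /=; apply: ler_sum => i _.
set a := f _; set b := g _; set c := f _; set d := g _.
by have := sqr_ge0 ((a - c) - (b - d)); nra.
Qed.

(** Recording the end points of the list makes concatenation possible; for arbitrary
partitions the gap between two lists could exceed the mesh. *)
Definition reaches f (delta x y e : R) : Prop :=
  exists l, [/\ path <%R x l, last x l = y, mesh (x :: l) < delta
              & e <= qv f (x :: l)].

Lemma reaches_trans f delta x y z e e' :
  reaches f delta x y e -> reaches f delta y z e' ->
  reaches f delta x z (e + e').
Proof.
move=> [l [pl ll ml el]] [l' [pl' ll' ml' el']]; exists (l ++ l'); split.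
- by rewrite cat_path pl ll.
- by rewrite last_cat ll.
- by rewrite mesh_cat gt_max ml ll ml'.
- by rewrite qv_cat ll lerD.
Qed.

Lemma reaches_step f delta x y : 0 < delta -> x < y -> y - x < delta ->
  reaches f delta x y ((f y - f x) ^+ 2).
Proof.
move=> d0 xy yx; exists [:: y]; split => //=.
- by rewrite xy.
- by rewrite mesh_cons2 mesh1 gt_max yx.
- by rewrite qv_cons2 qv1 addr0.
Qed.

Lemma reaches_le f delta x y e e' : e' <= e ->
  reaches f delta x y e -> reaches f delta x y e'.
Proof. by move=> e'e [l [? ? ? ?]]; exists l; split => //; exact: le_trans e'e _. Qed.

Lemma reaches_0 f delta x y : 0 < delta -> x <= y -> reaches f delta x y 0.
Proof.
move=> d0 xy.
have [N /ltW] : exists N : nat, y - x < N%:R * (delta / 2).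
  exists (Num.truncn ((y - x) / (delta / 2))).+1.
  by rewrite -ltr_pdivrMr ?divr_gt0// truncnS_gt.
elim: N x xy => [|N IH] x xy.
  rewrite mul0r subr_le0 => yx.
  by exists [::]; rewrite /= mesh1 qv1; split => //; apply/le_anti/andP; split.
have [yx _|yx] := ltP (y - x) delta.
  have [->|nxy] := eqVneq x y.
    by exists [::]; rewrite /= mesh1 qv1; split.
  by apply: reaches_le (reaches_step f d0 _ yx); rewrite ?sqr_ge0// lt_neqAle nxy.
rewrite -natr1 mulrDl mul1r => yN.
rewrite -[0]addr0; apply: (@reaches_trans _ _ _ (x + delta / 2)).
  by apply: reaches_le (reaches_step f d0 _ _); [exact: sqr_ge0|lra|lra].
by apply: IH; lra.
Qed.

(** Once the intervals are sorted, energy-free paths join consecutive ones. *)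
Lemma reaches_disjoint (T : eqType) (s : seq T) (p q : T -> R) f delta x y :
  0 < delta -> x <= y ->
  {in s, forall j, [/\ x <= p j, p j < q j, q j <= y & q j - p j < delta]} ->
  uniq s -> {in s &, forall i j, i != j -> q i < p j \/ q j < p i} ->
  reaches f delta x y (\sum_(j <- s) (f (q j) - f (p j)) ^+ 2).
Proof.
move=> d0 xy pq us dis.
pose r := relpre p <=%R.
have rtot : total r by move=> i j; exact: le_total.
have rtr : transitive r by move=> j i k; exact: le_trans.
rewrite (perm_big (sort r s)) /=; last by rewrite perm_sym perm_sort.
have : uniq (sort r s) by rewrite sort_uniq.
have : {in sort r s &, forall i j, i != j -> q i < p j \/ q j < p i}.
  by move=> i j; rewrite !mem_sort; exact: dis.
have : {in sort r s, forall j, [/\ x <= p j, p j < q j, q j <= y & q j - p j < delta]}.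
  by move=> j; rewrite mem_sort; exact: pq.
have : sorted r (sort r s) by exact: sort_sorted.
elim: (sort r s) x xy {us dis pq} => [|i l IH] x xy /=.
  by move=> *; rewrite big_nil; exact: reaches_0.
move=> pl pq dis /andP[il ul]; rewrite big_cons.
have [xp pqi qy qpd] := pq i (mem_head _ _).
rewrite -[X in reaches _ _ _ _ X]add0r.
apply: (@reaches_trans _ _ _ (p i)); first exact: reaches_0.
apply: (@reaches_trans _ _ _ (q i)); first exact: reaches_step.
apply: IH => //.
- exact: path_sorted pl.
- move=> j jl; have [h1 h2 h3 h4] := pq j (mem_behead (s := i :: l) jl).
  split => //.
  have ij : i != j by apply: contraNneq il => ->.
  have [/ltW//|h] := dis i j (mem_head _ _) (mem_behead (s := i :: l) jl) ij.
  have /allP/(_ j jl) : all (r i) l by rewrite (order_path_min rtr).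
  by rewrite /r /= => h5; lra.
- by move=> j k jl kl; apply: dis; rewrite inE ?jl ?kl orbT.
Qed.

Lemma reaches_partition f delta x y e (I : set R) : x < y ->
  (forall t, x <= t <= y -> I t) -> reaches f delta x y e ->
  exists P, [/\ partition_in I P, mesh P < delta & e <= qv f P].
Proof.
move=> xy hI [l [pl ll ml el]]; exists (x :: l); split => //; split => //.
  by case: l pl ll {ml el} => //= _ lx; rewrite lx ltxx in xy.
have le_l : all (>= x) (x :: l).
  by apply: order_path_min le_trans _; rewrite /= lexx; apply: sub_path pl => u v /ltW.
have ge_l : {in x :: l, forall t, t <= y}.
  rewrite -ll; elim: l x pl {xy hI ll ml el le_l} => [|z l IH] x /=.
    by move=> _ t; rewrite inE => /eqP ->.
  move=> /andP[xz pl] t; rewrite inE => /predU1P[->|]; last exact: IH.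
  by apply: le_trans (ltW xz) _; apply: IH => //; exact: mem_head.
move=> t tl; apply: hI; apply/andP; split; last exact: ge_l.
by move: (allP le_l t tl).
Qed.

Lemma partition_reaches f I P : partition_in I P ->
  exists x y, [/\ I x, I y, x < y & forall delta, mesh P < delta -> reaches f delta x y (qv f P)].
Proof.
case: P => [|x l] [//= sl pl IP].
exists x, (last x l); split => //.
- by apply: IP; rewrite mem_head.
- by apply: IP; rewrite mem_last.
- case: l sl pl {IP} => //= z l _ /andP[xz].
  elim: l z xz => //= w l IH z xz /andP[zw]; apply: IH; exact: lt_trans zw.
- by move=> d md; exists l; split.
Qed.

End QuadraticVariationOfLists.

(** * Trapezoids *)

Section Trapezoids.
Context {R : realType}.
Implicit Types (t x y : R) (P : seq R).

Definition clamp t : R := Num.min 1 (Num.max 0 t).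

Lemma clamp_ge0 t : 0 <= clamp t.
Proof. by rewrite /clamp le_min ler01 le_max lexx. Qed.

Lemma clamp_le1 t : clamp t <= 1.
Proof. by rewrite /clamp ge_min lexx. Qed.

Lemma clamp_id t : 0 <= t <= 1 -> clamp t = t.
Proof. by move=> /andP[t0 t1]; rewrite /clamp (max_r t0) min_r. Qed.

Lemma clamp0 t : t <= 0 -> clamp t = 0.
Proof. by move=> t0; rewrite /clamp (max_l t0) min_r. Qed.

Lemma clamp1 t : 1 <= t -> clamp t = 1.
Proof. by move=> t1; rewrite /clamp (max_r (le_trans ler01 t1)) min_l. Qed.

Lemma ramp0 x y t : 0 < t -> x <= y -> clamp ((x - y) / t) = 0.
Proof. by move=> t0 xy; rewrite clamp0// pmulr_lle0 ?invr_gt0// subr_le0. Qed.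

Lemma ramp1 x y t : 0 < t -> t <= x - y -> clamp ((x - y) / t) = 1.
Proof. by move=> t0 txy; rewrite clamp1// ler_pdivlMr// mul1r. Qed.

Lemma clamp_homo : {homo clamp : x y / x <= y}.
Proof. by move=> x y xy; rewrite /clamp le_min2// le_max2. Qed.

Lemma clamp_lip x y : `|clamp x - clamp y| <= `|x - y|.
Proof.
wlog xy : x y / x <= y.
  by move=> H; have [/H//|/ltW/H] := leP x y; rewrite distrC (distrC y).
rewrite distrC (distrC x) !ger0_norm ?subr_ge0 ?clamp_homo//.
rewrite /clamp /Num.min /Num.max.
by case: (ltP 0 x) => ?; case: (ltP 0 y) => ?; case: ltP => ?; case: ltP => ?; lra.
Qed.

Definition lipschitz1 (f : R -> R) : Prop :=
  exists2 k : R, 0 <= k & forall x y, `|f x - f y| <= k * `|x - y|.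

Lemma lipschitz1Z k f : lipschitz1 f -> lipschitz1 (fun t => k * f t).
Proof.
move=> [l l0 fl]; exists (`|k| * l); first by rewrite mulr_ge0.
by move=> x y; rewrite -mulrBr normrM -mulrA ler_wpM2l.
Qed.

Lemma lipschitz1_sum (I : Type) (s : seq I) (f : I -> R -> R) :
  (forall i, lipschitz1 (f i)) -> lipschitz1 (fun t => \sum_(i <- s) f i t).
Proof.
move=> fl; elim: s => [|i s [k k0 IH]].
  by exists 0 => // x y; rewrite !big_nil subrr normr0 mul0r.
have [l l0 fil] := fl i; exists (l + k); first by rewrite addr_ge0.
move=> x y; rewrite !big_cons opprD addrACA mulrDl.
by apply: le_trans (ler_normD _ _) _; rewrite lerD.
Qed.

Lemma lipschitz1_continuous f : lipschitz1 f -> continuous f.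
Proof.
move=> [k k0 fk] z; apply/cvgrPdist_lt => e e0.
have k1 : 0 < k + 1 by lra.
near=> t; apply: le_lt_trans (fk z t) _.
apply: (@le_lt_trans _ _ ((k + 1) * `|z - t|)).
  by rewrite ler_wpM2r// lerDl.
rewrite mulrC -ltr_pdivlMr//.
by near: t; apply: (nbhsx_ballx z (e / (k + 1))); rewrite divr_gt0.
Unshelve. all: by end_near.
Qed.

(** The affine pieces of a trapezoid are given on half-open intervals; continuity
extends them to the missing end points. *)
Lemma eq_at_limit (h1 h2 : R -> R) x y z : continuous h1 -> continuous h2 ->
  x < y -> x <= z <= y -> (forall t, x < t < y -> h1 t = h2 t) -> h1 z = h2 z.
Proof.
move=> c1 c2 xy /andP[xz zy] h12; apply/eqP; rewrite -subr_eq0; apply/negPn/negP => nz.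
have c : h1 t - h2 t @[t --> z] --> h1 z - h2 z by apply: cvgB; [exact: c1|exact: c2].
have n0 : 0 < `|h1 z - h2 z| by rewrite normr_gt0.
have /cvgrPdist_lt/(_ _ n0)/nbhs_ballP[e /= e0 be] := c.
pose l := Num.max x (z - e); pose r := Num.min y (z + e).
have [lx le ry re] : [/\ x <= l, z - e <= l, r <= y & r <= z + e].
  by split; rewrite /l /r ?le_max ?ge_min lexx ?orbT.
have lr : l < r.
  by rewrite /l /r gt_max !lt_min xy /=; apply/and3P; split; lra.
pose m := (l + r) / 2.
have zm : ball z e m by rewrite /ball /= /m ltr_distl; apply/andP; split; lra.
have := be m zm; rewrite /= [h1 m]h12 ?subrr ?subr0 ?ltxx//.
by rewrite /m; apply/andP; split; lra.
Qed.

Section OneTrapezoid.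
Variables (a b c d : R) (g : R -> R).
Hypotheses (ac : a < c) (cd : c < d) (db : d < b) (gc : continuous g).
Hypotheses (g1 : forall t, c <= t <= d -> g t = 1)
           (g0 : forall t, ~ (a <= t <= b) -> g t = 0)
           (gl : exists p q : R, forall t, a <= t < c -> g t = p * t + q)
           (gr : exists p q : R, forall t, d < t <= b -> g t = p * t + q).

Let affine_continuous (p q : R) : continuous (fun t => p * t + q).
Proof. by move=> z; apply: cvgD; [apply: cvgM; [exact: cvg_cst|exact: cvg_id]|exact: cvg_cst]. Qed.

Let cst0_continuous : continuous (fun _ : R => 0 : R).
Proof. by move=> z; exact: cvg_cst. Qed.

(** Writing a trapezoid as a difference of two nondecreasing ramps gives at once
its Lipschitz constant and the bound [2] on its total variation. *)
Lemma trapezoidE t : g t = clamp ((t - a) / (c - a)) - clamp ((t - d) / (b - d)).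
Proof.
have [ac' cd' db'] : [/\ a < c, c < d & d < b] by [].
have ca0 : 0 < c - a by rewrite subr_gt0.
have bd0 : 0 < b - d by rewrite subr_gt0.
have ga : g a = 0.
  apply: (@eq_at_limit g (fun=> 0) (a - 1) a) => //; [lra|apply/andP; split; lra|].
  by move=> u /andP[_ ua]; apply: g0; rewrite leNgt ua.
have gb : g b = 0.
  apply: (@eq_at_limit g (fun=> 0) b (b + 1)) => //; [lra|apply/andP; split; lra|].
  by move=> u /andP[ub _]; apply: g0; rewrite andbC leNgt ub.
have gleft : forall u, a <= u <= c -> g u = (u - a) / (c - a).
  have [p [q pq]] := gl.
  have h u : a <= u <= c -> g u = p * u + q.
    move=> uac; apply: (@eq_at_limit g (fun t => p * t + q) a c) => //.
    by move=> w /andP[aw wc]; apply: pq; rewrite (ltW aw).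
  have ha : p * a + q = 0 by rewrite -h// lexx ltW.
  have hc : p * c + q = 1 by rewrite -h ?lexx ?(ltW ac)// g1// lexx ltW.
  have hp : p = 1 / (c - a).
    by apply: (canRL (mulfK _)); [exact: lt0r_neq0|lra].
  move=> u /h ->; have -> : q = - p * a by lra.
  by rewrite hp; field; exact: lt0r_neq0.
have gright : forall u, d <= u <= b -> g u = (b - u) / (b - d).
  have [p [q pq]] := gr.
  have h u : d <= u <= b -> g u = p * u + q.
    move=> udb; apply: (@eq_at_limit g (fun t => p * t + q) d b) => //.
    by move=> w /andP[dw wb]; apply: pq; rewrite dw (ltW wb).
  have hb : p * b + q = 0 by rewrite -h// lexx andbT ltW.
  have hd : p * d + q = 1 by rewrite -h ?lexx ?(ltW db)// g1// lexx andbT ltW.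
  have hp : p = - 1 / (b - d).
    by apply: (canRL (mulfK _)); [exact: lt0r_neq0|lra].
  move=> u /h ->; have -> : q = - p * b by lra.
  by rewrite hp; field; exact: lt0r_neq0.
have [ta|ta] := leP t a.
  have td : t <= d by exact: le_trans ta (ltW (lt_trans ac cd)).
  rewrite !ramp0 ?subrr//.
  have [->//|nta] := eqVneq t a.
  by apply: g0 => /andP[at_ _]; move: nta; rewrite eq_le ta at_.
have [tc|tc] := leP t c.
  rewrite gleft ?(ltW ta)// (@ramp0 t d) ?subr0//; last by lra.
  rewrite clamp_id// divr_ge0 ?(ltW ca0) ?subr_ge0 ?(ltW ta)//=.
  by rewrite ler_pdivrMr// mul1r; lra.
rewrite ramp1//; last by lra.
have [td|td] := leP t d.
  by rewrite g1 ?(ltW tc)// ramp0 ?subr0.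
have [tb|tb] := leP t b.
  rewrite gright ?(ltW td)// clamp_id; first by field; exact: lt0r_neq0.
  rewrite divr_ge0 ?(ltW bd0) ?subr_ge0 ?(ltW td)//=.
  by rewrite ler_pdivrMr// mul1r; lra.
rewrite ramp1 ?subrr//; last by lra.
by apply: g0; rewrite andbC leNgt tb.
Qed.

Lemma trapezoid_bounds t : 0 <= g t <= 1.
Proof.
rewrite trapezoidE.
have [ac' cd' db'] : [/\ a < c, c < d & d < b] by [].
have ca0 : 0 < c - a by rewrite subr_gt0.
have bd0 : 0 < b - d by rewrite subr_gt0.
have [td|td] := leP t d.
  by rewrite (@ramp0 t d)// subr0 clamp_ge0 clamp_le1.
rewrite ramp1//; last by lra.
by rewrite subr_ge0 clamp_le1 lerBlDr lerDl clamp_ge0.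
Qed.

Lemma trapezoid0 t : t <= a \/ b <= t -> g t = 0.
Proof.
have [ac' cd' db'] : [/\ a < c, c < d & d < b] by [].
have ca0 : 0 < c - a by rewrite subr_gt0.
have bd0 : 0 < b - d by rewrite subr_gt0.
rewrite trapezoidE => -[ta|bt].
  by rewrite !ramp0 ?subrr//; lra.
by rewrite !ramp1 ?subrr//; lra.
Qed.

Lemma trapezoid_lipschitz : lipschitz1 g.
Proof.
have [ac' cd' db'] : [/\ a < c, c < d & d < b] by [].
have ca0 : 0 < c - a by rewrite subr_gt0.
have bd0 : 0 < b - d by rewrite subr_gt0.
exists ((c - a)^-1 + (b - d)^-1).
  by rewrite addr_ge0 // invr_ge0 ltW.
move=> x y; rewrite !trapezoidE [leRHS]mulrDl.
set A := clamp _; set B := clamp _; set C := clamp _; set D := clamp _.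
have -> : A - B - (C - D) = (A - C) - (B - D) by ring.
apply: le_trans (ler_normB _ _) _; apply: lerD.
- apply: le_trans (clamp_lip _ _) _.
  rewrite -mulrBl (_ : x - a - (y - a) = x - y); last by ring.
  by rewrite normrM [X in _ * X]gtr0_norm ?invr_gt0// mulrC.
- apply: le_trans (clamp_lip _ _) _.
  rewrite -mulrBl (_ : x - d - (y - d) = x - y); last by ring.
  by rewrite normrM [X in _ * X]gtr0_norm ?invr_gt0// mulrC.
Qed.

Lemma trapezoid_variation P : sorted <%R P ->
  \sum_(i < (size P).-1) `|g P`_i.+1 - g P`_i| <= 2.
Proof.
have [ac' cd' db'] : [/\ a < c, c < d & d < b] by [].
have ca0 : 0 < c - a by rewrite subr_gt0.
have bd0 : 0 < b - d by rewrite subr_gt0.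
case: P => [|x l]; first by rewrite big_ord0.
pose u t := clamp ((t - a) / (c - a)) + clamp ((t - d) / (b - d)).
suff H : sorted <%R (x :: l) ->
    \sum_(i < size l) `|g (x :: l)`_i.+1 - g (x :: l)`_i| <= u (last x l) - u x.
  move=> /H /le_trans; apply; rewrite /u.
  set A := clamp _; set B := clamp _; set C := clamp _; set D := clamp _.
  have := clamp_le1 ((last x l - a) / (c - a)); have := clamp_le1 ((last x l - d) / (b - d)).
  have := clamp_ge0 ((x - a) / (c - a)); have := clamp_ge0 ((x - d) / (b - d)).
  by rewrite -/A -/B -/C -/D; lra.
elim: l x => [|y l IH] x /=; first by rewrite big_ord0 subrr.
move=> /andP[xy yl]; rewrite big_ord_recl /=.
have := IH _ yl.
set S := \sum_(i < _) _.
have : `|g y - g x| <= u y - u x; last by lra.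
rewrite !trapezoidE /u.
have := @clamp_homo ((x - a) / (c - a)) ((y - a) / (c - a)).
have := @clamp_homo ((x - d) / (b - d)) ((y - d) / (b - d)).
rewrite !ler_pM2r ?invr_gt0// !lerD2r ltW// => /(_ isT) h1 /(_ isT) h2.
by rewrite ler_norml; apply/andP; split; lra.
Qed.

End OneTrapezoid.
End Trapezoids.

(** * Bumps in an ordered tree of trapezoids *)

Section Words.

(** A chain goes from a node to the left successor of its right successor.  This
leaves the left successor free on its left and the right successor of the right
successor free on its right. *)
Definition step : seq bool := [:: true; false].
Definition side_word (sd : bool) : seq bool :=
  if sd then [:: true; true] else [:: false].
Definition chain_word (i : nat) : seq bool := iter i (cat^~ step) [::].

(** The letter [(i, (sd, bt))] selects, at the [i]-th node of a chain, the side
[sd] of the chain, and on this side the bump of the successor [bt]. *)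
Definition letter : Type := (nat * (bool * bool))%type.
Definition letter_word (e : letter) : seq bool :=
  rcons (chain_word e.1 ++ side_word e.2.1) e.2.2.
Definition node (u : seq letter) : seq bool := flatten (map letter_word u).
Definition label (u : seq letter) : seq bool := [seq e.2.2 | e <- u].
Definition chain u i : seq bool := node u ++ chain_word i.
Definition side u i sd : seq bool := chain u i ++ side_word sd.

Lemma chain0 u : chain u 0 = node u.
Proof. by rewrite /chain /= cats0. Qed.

Lemma chainS u i : chain u i.+1 = rcons (rcons (chain u i) true) false.
Proof. by rewrite /chain /= /step -!cats1 -!catA. Qed.

Lemma chain_cat u i : chain u i.+1 = chain u i ++ step.
Proof. by rewrite /chain /= catA. Qed.

Lemma node_cat u v : node (u ++ v) = node u ++ node v.
Proof. by rewrite /node map_cat flatten_cat. Qed.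

Lemma node_rcons u e : node (rcons u e) = rcons (side u e.1 e.2.1) e.2.2.
Proof.
by rewrite -cats1 node_cat /node /= cats0 /letter_word /side /chain -rcons_cat catA.
Qed.

Lemma label_rcons u e : label (rcons u e) = rcons (label u) e.2.2.
Proof. exact: map_rcons. Qed.

Lemma label_take k u : label (take k u) = take k (label u).
Proof. exact: map_take. Qed.

Lemma size_label u : size (label u) = size u.
Proof. exact: size_map. Qed.

(** With this length [2 * chain_length n], the number of bumps of the next level with
a given label above a bump of level [n], is the square of the ratio of the two
amplitudes,
and the errors of order [1 / chain_length n], summed over the [2 ^ n] labels of
level [n], form a convergent series. *)
Definition chain_length (n : nat) : nat := (8 * 16 ^ n)%N.

Lemma chain_length_gt0 n : (0 < chain_length n)%N.
Proof. by rewrite muln_gt0 expn_gt0. Qed.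

End Words.

Section OrderedTree.
Context {R : realType}.
Variables (a b c d : seq bool -> R) (g : seq bool -> R -> R).
Hypothesis hT : tree_family_of_trapezoids a b c d g.
Hypothesis hO : forall s, b (rcons s false) < a (rcons s true).
Implicit Types (t x y : R) (P : seq R) (s r : seq bool) (u v : seq letter).

Lemma tree_nodeP s : [/\ 0 <= a s, a s < c s, c s < d s, d s < b s & b s <= 1].
Proof. by have [[? ? [? ? ?]] _ _ _] := hT s. Qed.

Lemma tree_lt s : [/\ a s < c s, c s < d s, d s < b s & a s < b s].
Proof. by have [_ h1 h2 h3 _] := tree_nodeP s; split => //; lra. Qed.

Lemma tree_child s i : c s <= a (rcons s i) /\ b (rcons s i) <= d s.
Proof.
have [_ _ /(_ i) sub _] := hT s; have [_ _ _ ab] := tree_lt (rcons s i).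
have := sub (a (rcons s i)); have := sub (b (rcons s i)).
rewrite /= !in_itv /= !lexx (ltW ab) /= => /(_ isT)/andP[_ ->] /(_ isT)/andP[-> _].
by [].
Qed.

Lemma tree_g1 s t : c s <= t <= d s -> g s t = 1.
Proof. by move=> h; have [_ [_ g1 _ _ _] _ _] := hT s; apply: g1; rewrite /= in_itv. Qed.

Lemma tree_g_continuous s : continuous (g s).
Proof. by have [_ []] := hT s. Qed.

Let tree_gE (Q : Prop) s :
  (forall (g1 : forall t, c s <= t <= d s -> g s t = 1)
         (g0 : forall t, ~ (a s <= t <= b s) -> g s t = 0)
         (gl : exists p q : R, forall t, a s <= t < c s -> g s t = p * t + q)
         (gr : exists p q : R, forall t, d s < t <= b s -> g s t = p * t + q), Q) -> Q.
Proof.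
have [_ [_ g1 g0 gl gr] _ _] := hT s; apply.
- exact: tree_g1.
- by move=> t nt; apply: g0; rewrite /= in_itv.
- by have [p [q h]] := gl; exists p, q => t ht; apply: h; rewrite /= in_itv.
- by have [p [q h]] := gr; exists p, q => t ht; apply: h; rewrite /= in_itv.
Qed.

Lemma tree_g0 s t : t <= a s \/ b s <= t -> g s t = 0.
Proof.
have [h1 h2 h3 _] := tree_lt s; apply: (@tree_gE _ s) => g1 g0 gl gr.
exact: (trapezoid0 h1 h2 h3 (@tree_g_continuous s) g1 g0 gl gr).
Qed.

Lemma tree_g_bounds s t : 0 <= g s t <= 1.
Proof.
have [h1 h2 h3 _] := tree_lt s; apply: (@tree_gE _ s) => g1 g0 gl gr.
exact: (trapezoid_bounds h1 h2 h3 (@tree_g_continuous s) g1 g0 gl gr).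
Qed.

Lemma tree_g_lipschitz s : lipschitz1 (g s).
Proof.
have [h1 h2 h3 _] := tree_lt s; apply: (@tree_gE _ s) => g1 g0 gl gr.
exact: (trapezoid_lipschitz h1 h2 h3 (@tree_g_continuous s) g1 g0 gl gr).
Qed.

Lemma tree_g_variation s P : sorted <%R P ->
  \sum_(i < (size P).-1) `|g s P`_i.+1 - g s P`_i| <= 2.
Proof.
have [h1 h2 h3 _] := tree_lt s; apply: (@tree_gE _ s) => g1 g0 gl gr.
exact: (trapezoid_variation h1 h2 h3 (@tree_g_continuous s) g1 g0 gl gr).
Qed.

Lemma tree_desc s r : a s <= a (s ++ r) /\ b (s ++ r) <= b s.
Proof.
elim/last_ind: r => [|r i [IH1 IH2]]; first by rewrite cats0.
rewrite -rcons_cat; have [h1 h2] := tree_child (s ++ r) i.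
have [l1 l2 l3 l4] := tree_lt (s ++ r).
by split; lra.
Qed.

Lemma tree_sdesc s r : r != [::] -> c s <= a (s ++ r) /\ b (s ++ r) <= d s.
Proof.
case: r => // i r _; rewrite -cat_rcons.
have [h1 h2] := tree_child s i; have [h3 h4] := tree_desc (rcons s i) r.
by split; lra.
Qed.

Lemma chain_mono u i j : (i <= j)%N ->
  [/\ a (chain u i) <= a (chain u j), c (chain u i) <= c (chain u j),
      d (chain u j) <= d (chain u i) & b (chain u j) <= b (chain u i)].
Proof.
move=> /subnKC <-; elim: (j - i)%N => [|k [h1 h2 h3 h4]]; first by rewrite addn0.
rewrite addnS chain_cat.
have [i1 i2] := @tree_sdesc (chain u (i + k)) step isT.
have [l1 l2 l3 l4] := tree_lt (chain u (i + k)).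
have [m1 m2 m3 m4] := tree_lt (chain u (i + k) ++ step).
by split; lra.
Qed.

Lemma side_in u i sd :
  c (chain u i) <= a (side u i sd) /\ b (side u i sd) <= d (chain u i).
Proof. by apply: tree_sdesc; case: sd. Qed.

Lemma side_left u i : b (side u i false) < a (chain u i.+1).
Proof.
rewrite chainS /side /= cats1; have := hO (chain u i).
have [h1 _] := tree_child (rcons (chain u i) true) false.
by have [l1 _ _ _] := tree_lt (rcons (chain u i) true); lra.
Qed.

Lemma side_right u i : b (chain u i.+1) < a (side u i true).
Proof.
have -> : side u i true = rcons (rcons (chain u i) true) true.
  by rewrite /side -!cats1 -!catA.
by rewrite chainS; exact: hO.
Qed.

Lemma side_chain u i j sd : (i < j)%N ->
  b (side u i sd) < a (chain u j) \/ b (chain u j) < a (side u i sd).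
Proof.
move=> ij; have [h1 h2 h3 h4] := chain_mono u ij.
case: sd; [right; have := side_right u i|left; have := side_left u i]; lra.
Qed.

Lemma child_in u e : c (side u e.1 e.2.1) <= a (node (rcons u e)) /\
  b (node (rcons u e)) <= d (side u e.1 e.2.1).
Proof. by rewrite node_rcons; exact: tree_child. Qed.

Lemma node_desc u v : a (node u) <= a (node (u ++ v)) /\
  b (node (u ++ v)) <= b (node u).
Proof. by rewrite node_cat; exact: tree_desc. Qed.

Lemma node_sdesc u v : v != [::] -> c (node u) <= a (node (u ++ v)) /\
  b (node (u ++ v)) <= d (node u).
Proof.
case: v => // e v _; rewrite node_cat; apply: tree_sdesc.
by rewrite /node /= /letter_word; case: (_ ++ side_word _).
Qed.

(** Bumps of one level are separated by the chain of their last common ancestor,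
or, on a common side of it, by the tree itself. *)
Lemma node_disjoint u v : size u = size v -> u != v ->
  b (node u) < a (node v) \/ b (node v) < a (node u).
Proof.
elim/last_ind: u v => [|u e IH] v; first by case: v.
elim/last_ind: v => [|v f _]; first by rewrite size_rcons.
rewrite !size_rcons eqseq_rcons negb_and => -[suv].
have [uv|uv _] := eqVneq u v; last first.
  have [h1 h2] := node_desc u [:: e]; have [h3 h4] := node_desc v [:: f].
  by rewrite !cats1 in h1 h2 h3 h4; have [] := IH v suv uv; [left|right]; lra.
move=> {suv}; rewrite -{v}uv /= => ef.
have [e1 e2] := child_in u e; have [f1 f2] := child_in u f.
have [a1 a2 a3 a4] := tree_lt (side u e.1 e.2.1).
have [b1 b2 b3 b4] := tree_lt (side u f.1 f.2.1).
case: e f ef e1 e2 f1 f2 a1 a2 a3 a4 b1 b2 b3 b4 => [i [sd bt]] [j [sd' bt']] /=.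
rewrite !xpair_eqE => ef e1 e2 f1 f2 a1 a2 a3 a4 b1 b2 b3 b4.
have [s1 s2] := side_in u i sd; have [s3 s4] := side_in u j sd'.
have [t1 t2 t3 t4] := tree_lt (chain u i); have [t5 t6 t7 t8] := tree_lt (chain u j).
have [ij|ji|ij] := ltngtP i j.
- by have [] := side_chain u sd ij; [left|right]; lra.
- by have [] := side_chain u sd' ji; [right|left]; lra.
rewrite -{j}ij eqxx /= in ef s3 s4 f1 f2 b1 b2 b3 b4 t5 t6 t7 t8 *.
have := side_left u i; have := side_right u i.
have [v1 v2 v3 v4] := tree_lt (chain u i.+1).
case: sd sd' ef e1 e2 f1 f2 a1 a2 a3 a4 b1 b2 b3 b4 s1 s2 s3 s4 => -[] /=.
- move=> ef *; rewrite !node_rcons /=; clear -ef hO.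
  by case: bt bt' ef => -[]// _; [right|left]; exact: hO.
- by move=> *; right; lra.
- by move=> *; left; lra.
- move=> ef *; rewrite !node_rcons /=; clear -ef hO.
  by case: bt bt' ef => -[]// _; [right|left]; exact: hO.
Qed.

(** A bump climbs from 0 to 1 in many small steps along a chain of nested
trapezoids.  Both sides of every step carry bumps of the next level, so that it
cannot cover a large increment without skipping many of them. *)
Definition phi u t : R :=
  (chain_length (size u))%:R^-1 * \sum_(i < chain_length (size u)) g (chain u i) t.

Definition top u : R := c (chain u (chain_length (size u)).-1).

Let K_gt0 u : 0 < (chain_length (size u))%:R :> R.
Proof. by rewrite ltr0n chain_length_gt0. Qed.

Lemma phi_out u t : t <= a (node u) \/ b (node u) <= t -> phi u t = 0.
Proof.
move=> ht; rewrite /phi big1 ?mulr0// => i _; apply: tree_g0.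
have [h1 h2] := tree_desc (node u) (chain_word i).
by rewrite /chain; case: ht => ?; [left|right]; lra.
Qed.

Lemma phi_bounds u t : 0 <= phi u t <= 1.
Proof.
rewrite /phi mulr_ge0 ?invr_ge0 ?ler0n//=; last first.
  by apply: sumr_ge0 => i _; have /andP[] := tree_g_bounds (chain u i) t.
rewrite mulrC ler_pdivrMr// mul1r.
rewrite -[X in _ <= X%:R]card_ord -sumr_const.
by apply: ler_sum => i _; have /andP[] := tree_g_bounds (chain u i) t.
Qed.

Lemma phi_variation u P : sorted <%R P ->
  \sum_(i < (size P).-1) `|phi u P`_i.+1 - phi u P`_i| <= 2.
Proof.
move=> sP; rewrite /phi.
under eq_bigr do rewrite -mulrBr normrM ger0_norm ?invr_ge0 ?ler0n//.
rewrite -mulr_sumr mulrC ler_pdivrMr//.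
apply: (@le_trans _ _ (\sum_(i < (size P).-1) \sum_(j < chain_length (size u))
    `|g (chain u j) P`_i.+1 - g (chain u j) P`_i|)).
  by apply: ler_sum => i _; rewrite -sumrB; exact: ler_norm_sum.
rewrite exchange_big /= mulr_natr -[X in _ *+ X]card_ord -sumr_const.
by apply: ler_sum => j _; exact: tree_g_variation.
Qed.

Lemma phi_top u : phi u (top u) = 1.
Proof.
rewrite /phi (eq_bigr (fun=> 1)); last first.
  move=> i _; apply: tree_g1; rewrite /top.
  have iK : (i <= (chain_length (size u)).-1)%N.
    by rewrite -ltnS prednK ?chain_length_gt0.
  have [_ h1 h2 _] := chain_mono u iK.
  have [_ h3 _ _] := tree_lt (chain u (chain_length (size u)).-1).
  by apply/andP; split; lra.
by rewrite sumr_const card_ord mulVf// gt_eqF.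
Qed.

Lemma top_in u : c (node u) <= top u < d (node u).
Proof.
have [_ h1 h2 _] := chain_mono u (leq0n (chain_length (size u)).-1).
rewrite chain0 in h1 h2; have := tree_lt (chain u (chain_length (size u)).-1).
by rewrite /top => -[*]; apply/andP; split; lra.
Qed.

Lemma phi_side u i sd t t' : a (side u i sd) <= t <= b (side u i sd) ->
  a (side u i sd) <= t' <= b (side u i sd) -> phi u t = phi u t'.
Proof.
suff H z : a (side u i sd) <= z <= b (side u i sd) -> forall j,
    g (chain u j) z = if (j <= i)%N then 1 else 0.
  move=> ht ht'; congr (_ * _); apply: eq_bigr => j _.
  by rewrite (H t)// (H t').
move=> /andP[z1 z2] j; have [s1 s2] := side_in u i sd; case: leqP => ij.
  by apply: tree_g1; have [? ? ? ?] := chain_mono u ij; apply/andP; split; lra.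
by apply: tree_g0; have [?|?] := side_chain u sd ij; [left|right]; lra.
Qed.

Lemma phi_ancestor u v t t' : (size v < size u)%N ->
  a (node u) <= t <= b (node u) -> a (node u) <= t' <= b (node u) ->
  phi v t = phi v t'.
Proof.
move=> vu; have [E|nv] := eqVneq (take (size v) u) v; last first.
  move=> /andP[t1 t2] /andP[t3 t4].
  have sv : size (take (size v) u) = size v by rewrite size_takel// ltnW.
  have := node_desc (take (size v) u) (drop (size v) u).
  rewrite cat_take_drop => -[h1 h2].
  by have [h|h] := node_disjoint sv nv; rewrite !phi_out//;
    try (by left; lra); right; lra.
have := cat_take_drop (size v) u; rewrite E.
case Ed : (drop (size v) u) => [|[i [sd bt]] w] uE.
  by move: vu; rewrite -subn_gt0 -size_drop Ed.
rewrite -uE -cat_rcons.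
have [h1 h2] := node_desc (rcons v (i, (sd, bt))) w.
have [h3 h4] := child_in v (i, (sd, bt)); rewrite /= in h3 h4.
have [h5 _ h6 _] := tree_lt (side v i sd).
by move=> /andP[t1 t2] /andP[t3 t4]; apply: (@phi_side v i sd); apply/andP; split; lra.
Qed.

Lemma phi_descendant u v : (size u < size v)%N ->
  phi v (a (node u)) = 0 /\ phi v (top u) = 0.
Proof.
move=> uv; have := node_desc (take (size u) v) (drop (size u) v).
rewrite cat_take_drop => -[h1 h2].
have /andP[k1 k2] := top_in u; have [l1 l2 l3 l4] := tree_lt (node u).
have [E|nv] := eqVneq (take (size u) v) u; last first.
  have sv : size (take (size u) v) = size u by rewrite size_takel// ltnW.
  by have [h|h] := node_disjoint sv nv; split; rewrite !phi_out//;
    try (by left; lra); right; lra.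
have := cat_take_drop (size u) v; rewrite E.
case Ed : (drop (size u) v) => [|[i [sd bt]] w] vE.
  by move: uv; rewrite -subn_gt0 -size_drop Ed.
have [n1 n2] := @node_sdesc u ((i, (sd, bt)) :: w) isT.
rewrite vE in n1 n2; split; first by apply: phi_out; left; lra.
apply: phi_out; rewrite -vE -cat_rcons.
have [h3 h4] := node_desc (rcons u (i, (sd, bt))) w.
have [h5 h6] := child_in u (i, (sd, bt)); rewrite /= in h5 h6.
have [h7 _ h8 _] := tree_lt (side u i sd).
have [s1 s2] := side_in u i sd; rewrite /top.
have [iK|iK] := leqP (chain_length (size u)).-1 i.
  by left; have [_ ? _ _] := chain_mono u iK; lra.
have [? ? ? ?] := tree_lt (chain u (chain_length (size u)).-1).
by have [?|?] := side_chain u sd iK; [right|left]; lra.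
Qed.

(** The earlier levels are constant on a whole bump, the other bumps of the same
level are supported elsewhere, and the later ones vanish at both points.  So the
coordinates of a combination of bumps can be read off exactly. *)
Lemma phi_foot_top u v :
  phi v (top u) - phi v (a (node u)) = (v == u)%:R.
Proof.
have /andP[k1 k2] := top_in u; have [l1 l2 l3 l4] := tree_lt (node u).
have [->|vu] := eqVneq v u.
  by rewrite phi_top phi_out ?subr0//; left.
have [svu|suv|suv] := ltngtP (size v) (size u).
- by rewrite (@phi_ancestor u v (top u) (a (node u))) ?subrr//; apply/andP; split; lra.
- by have [-> ->] := phi_descendant suv; rewrite subrr.
- by have [h|h] := node_disjoint suv vu; rewrite !phi_out ?subrr//;
    try (by left; lra); right; lra.
Qed.

Lemma phi_lipschitz u : lipschitz1 (phi u).
Proof.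
apply: lipschitz1Z; apply: lipschitz1_sum => i; exact: tree_g_lipschitz.
Qed.

End OrderedTree.

(** * Sums over the levels of the bumps *)

Section Sums.
Context {R : realType}.

Lemma pairwise_single (T : eqType) (s : seq T) (z : T -> R) :
  pairwise (fun u v => (z u == 0) || (z v == 0)) s ->
  (\sum_(u <- s) z u = 0 /\ \sum_(u <- s) z u ^+ 2 = 0) \/
  (exists2 u, u \in s & \sum_(v <- s) z v = z u /\ \sum_(v <- s) z v ^+ 2 = z u ^+ 2).
Proof.
elim: s => [|u s IH] /=; first by left; rewrite !big_nil.
move=> /andP[/allP us /IH{}IH]; rewrite !big_cons.
have [zu|zu] := eqVneq (z u) 0.
  rewrite zu !add0r expr0n /= add0r.
  case: IH => [|[v vs]]; [by left|right; exists v => //].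
  by rewrite inE vs orbT.
right; exists u; first exact: mem_head.
have z0 v : v \in s -> z v = 0 by move=> /us; rewrite (negbTE zu) => /eqP.
by rewrite !big1_seq ?addr0// => v /z0 ->; rewrite expr0n.
Qed.

(** For one level of bumps, [y] and [z] are the values at the two ends of an
increment: each end belongs to at most one bump, so that at most two differences
are nonzero. *)
Lemma sqr_sum_two (T : eqType) (s : seq T) (y z : T -> R) :
  pairwise (fun u v => (y u == 0) || (y v == 0)) s ->
  pairwise (fun u v => (z u == 0) || (z v == 0)) s ->
  (\sum_(u <- s) (y u - z u)) ^+ 2 <= 2 * \sum_(u <- s) (y u - z u) ^+ 2.
Proof.
have sq_single (w : T -> R) s' :
    pairwise (fun u v => (w u == 0) || (w v == 0)) s' ->
    (\sum_(u <- s') w u) ^+ 2 <= \sum_(u <- s') w u ^+ 2.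
  by case/pairwise_single => [[-> ->]|[v _ [-> ->]]]//; rewrite expr0n.
have zero_sum (w : T -> R) s' : {in s', forall v, w v = 0} -> \sum_(u <- s') w u = 0.
  by move=> w0; rewrite big1_seq.
elim: s => [|u s IH] /=; first by rewrite !big_nil expr0n mulr0.
move=> /andP[/allP yu ys] /andP[/allP zu zs]; rewrite !big_cons mulrDr.
have {}yu : y u != 0 -> {in s, forall v, y v = 0}.
  by move=> nyu v /yu; rewrite (negbTE nyu) => /eqP.
have {}zu : z u != 0 -> {in s, forall v, z v = 0}.
  by move=> nzu v /zu; rewrite (negbTE nzu) => /eqP.
have key (A S Q : R) : S ^+ 2 <= Q -> (A + S) ^+ 2 <= 2 * A ^+ 2 + 2 * Q.
  by move=> SQ; have := sqr_ge0 (A - S); nra.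
have [y0|/yu ny] := eqVneq (y u) 0; have [z0|/zu nz] := eqVneq (z u) 0.
- by rewrite y0 z0 subrr add0r expr0n mulr0 add0r; exact: IH.
- apply: key; have -> : \sum_(v <- s) (y v - z v) = \sum_(v <- s) y v.
    by apply: eq_big_seq => v vs; rewrite nz ?subr0.
  have -> : \sum_(v <- s) (y v - z v) ^+ 2 = \sum_(v <- s) y v ^+ 2.
    by apply: eq_big_seq => v vs; rewrite nz ?subr0.
  exact: sq_single.
- apply: key; have -> : \sum_(v <- s) (y v - z v) = - \sum_(v <- s) z v.
    by rewrite -sumrN; apply: eq_big_seq => v vs; rewrite ny ?sub0r.
  have -> : \sum_(v <- s) (y v - z v) ^+ 2 = \sum_(v <- s) z v ^+ 2.
    by apply: eq_big_seq => v vs; rewrite ny ?sub0r ?sqrrN.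
  by rewrite sqrrN; exact: sq_single.
- apply: key; rewrite zero_sum; last by move=> v vs; rewrite ny ?nz ?subrr.
  by rewrite expr0n /=; apply: sumr_ge0 => v _; exact: sqr_ge0.
Qed.

(** In the expansion of the square, each term is paired with the whole tail that
follows it. *)
Lemma sqr_sum_tail (y r : nat -> R) N m : (m <= N)%N ->
  (forall k, (k < N)%N -> `|\sum_(k.+1 <= j < N) y j| <= r k) ->
  (\sum_(m <= k < N) y k) ^+ 2 <= \sum_(m <= k < N) (y k ^+ 2 + 2 * (`|y k| * r k)).
Proof.
move=> mN yr; rewrite -(subKn mN); elim: (N - m)%N (leq_subr m N) => [|n IH] nN.
  by rewrite subn0 !big_geq // expr0n.
have kN : (N - n.+1 < N)%N by rewrite ltn_subrL; case: N nN {yr mN IH}.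
rewrite !(big_ltn kN) -subSn// subSS.
have := yr _ kN; rewrite -subSn// subSS; have := IH (ltnW nN).
set T := \sum_(_ <= j < N) y j; set Y := y _; set S := \sum_(_ <= j < N) _; set r' := r _.
move=> h1 h2; have : Y * T <= `|Y| * r'.
  by apply: le_trans (ler_norm _) _; rewrite normrM ler_wpM2l.
by nra.
Qed.

End Sums.

Section Amplitudes.
Context {R : realType}.

Definition side_bits : seq (bool * bool) :=
  [:: (false, false); (false, true); (true, false); (true, true)].

Definition letters n : seq letter :=
  [seq (i, z) | i <- iota 0 (chain_length n), z <- side_bits].

Fixpoint bumps n : seq (seq letter) :=
  if n is m.+1 then [seq rcons u e | u <- bumps m, e <- letters m] else [:: [::]].

(** The ratio [4 ^ m.+1] of consecutive amplitudes beats the number [2 ^ m] of the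
labels of level [m] in the cross terms between levels. *)
Fixpoint amplitude n : R := if n is m.+1 then amplitude m / 4 ^+ m.+1 else 1.

Lemma amplitude_gt0 n : 0 < amplitude n.
Proof. by elim: n => [|n IH] //=; rewrite divr_gt0// exprn_gt0. Qed.

Lemma amplitude_ge0 n : 0 <= amplitude n. Proof. exact: ltW (amplitude_gt0 n). Qed.

Lemma amplitudeS_le n : 4 * amplitude n.+1 <= amplitude n.
Proof.
rewrite /= exprS invfM mulrCA mulVKf// ler_pdivrMr ?exprn_gt0// ler_peMr ?amplitude_ge0//.
by rewrite exprn_ege1// ler1n.
Qed.

Lemma amplitude_tail m N : \sum_(m <= k < N) amplitude k <= 2 * amplitude m.
Proof.
have [mN|Nm] := leqP m N; last first.
  by rewrite big_geq ?mulr_ge0 ?amplitude_ge0// ltnW.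
rewrite -(subKn mN); elim: (N - m)%N (leq_subr m N) => [|n IH] nN.
  by rewrite subn0 big_geq// mulr_ge0// amplitude_ge0.
have kN : (N - n.+1 < N)%N by rewrite ltn_subrL; case: N nN {mN IH}.
rewrite (big_ltn kN) -subSn// subSS; have := IH (ltnW nN).
have := amplitudeS_le (N - n.+1)%N; rewrite -subSn// subSS.
by have := amplitude_ge0 (N - n)%N; lra.
Qed.

Lemma amplitude_small (e : R) : 0 < e -> exists m, forall n, (m <= n)%N -> amplitude n <= e.
Proof.
move=> e0; have h n : amplitude n * n.+1%:R <= 1 :> R.
  elim: n => [|n IH]; first by rewrite mulr1.
  apply: le_trans IH; have := amplitudeS_le n.
  have := amplitude_ge0 n.+1; rewrite -[n.+2%:R]natr1 -[n.+1%:R]natr1.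
  have : 0 <= n%:R :> R by rewrite ler0n.
  by nra.
exists (Num.truncn e^-1) => n mn.
apply: (@le_trans _ _ (n.+1%:R^-1)).
  by rewrite -div1r ler_pdivlMr// ltr0n.
rewrite invf_ple ?posrE ?ltr0n//; apply: ltW.
by apply: lt_le_trans (truncnS_gt _) _; rewrite ler_nat.
Qed.

Lemma uniq_bumps n : uniq (bumps n).
Proof.
elim: n => // n IH /=; apply: allpairs_uniq => //; last first.
  by move=> [u e] [v f] _ _ /= /rcons_inj[-> ->].
by apply: allpairs_uniq => //; [exact: iota_uniq|move=> [i z] [j w] _ _ /= [-> ->]].
Qed.

Lemma size_mem_bumps n u : u \in bumps n -> size u = n.
Proof.
elim: n u => [|n IH] u /=; first by rewrite inE => /eqP ->.
by move=> /allpairsP[[v e] /= [/IH <- _ ->]]; rewrite size_rcons.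
Qed.

Lemma size_bumps n : (size (bumps n))%:R * amplitude n ^+ 2 = 2 ^+ n :> R.
Proof.
elim: n => [|n IH] /=; first by rewrite expr1n mulr1.
rewrite !size_allpairs size_iota /= !natrM natrX.
rewrite expr_div_n [X in _ = X]exprS -IH -!exprM mulnC exprM.
rewrite (_ : (4 : R) ^+ 2 = 16); last by ring.
by rewrite [16 ^+ n.+1]exprS; field; rewrite expf_neq0.
Qed.

Lemma sum_bumpsS (F : seq letter -> R) n s bt :
  \sum_(u <- bumps n.+1 | label u == rcons s bt) F u =
  \sum_(u <- bumps n | label u == s)
     \sum_(i < chain_length n) \sum_(sd : bool) F (rcons u (i : nat, (sd, bt))).
Proof.
rewrite /= big_mkcond big_allpairs_dep /= [RHS]big_mkcond /=. apply: eq_bigr => u _.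
rewrite big_allpairs_dep /= -(big_mkord xpredT (fun i => \sum_sd F (rcons u (i, (sd, bt))))) /index_iota subn0.
case: ifPn => us.
  apply: eq_bigr => i _; rewrite !big_cons big_nil big_bool /= !label_rcons /=.
  rewrite !eqseq_rcons us /=; case: bt => /=; rewrite ?add0r ?addr0 addrC//.
rewrite big1// => i _; rewrite !big_cons big_nil !label_rcons !eqseq_rcons.
by rewrite (negbTE us) /= !addr0.
Qed.

Lemma amplitudeS_sqr n :
  amplitude n.+1 ^+ 2 * (2 * (chain_length n)%:R) = amplitude n ^+ 2.
Proof.
rewrite /= expr_div_n -exprM mulnC exprM (_ : (4 : R) ^+ 2 = 16); last by ring.
by rewrite natrM natrX [16 ^+ n.+1]exprS; field; rewrite expf_neq0.
Qed.

(** Each bump has [2 * chain_length n] bumps above it for each successor of its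
label, and the square of the amplitude is divided by the same number. *)
Lemma sum_amplitude s :
  \sum_(u <- bumps (size s) | label u == s) amplitude (size s) ^+ 2 = 1 :> R.
Proof.
elim/last_ind: s => [|s bt IH].
  by rewrite big_cons big_nil /= expr1n addr0.
rewrite size_rcons (sum_bumpsS (fun=> _)) -[RHS]IH; apply: eq_bigr => u _.
rewrite -[RHS]amplitudeS_sqr sumr_const card_ord sumr_const card_bool.
by rewrite -mulrnA -[LHS]mulr_natr natrM.
Qed.

End Amplitudes.

(** * Almost orthogonality of the levels *)

Definition level {R : realType} (g : seq bool -> R -> R) (x : seq bool -> R) n t : R :=
  amplitude n * \sum_(u <- bumps n) x (label u) * phi g u t.

Definition partial {R : realType} (g : seq bool -> R -> R) (x : seq bool -> R) N t : R :=
  \sum_(0 <= n < N) level g x n t.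

Section AlmostOrthogonality.
Context {R : realType}.
Variables (a b c d : seq bool -> R) (g : seq bool -> R -> R).
Hypothesis hT : tree_family_of_trapezoids a b c d g.
Hypothesis hO : forall s, b (rcons s false) < a (rcons s true).
Implicit Types (t : R) (P : seq R) (x : seq bool -> R).

Lemma pairwise_phi (y : seq letter -> R) n t :
  pairwise (fun u v => (y u * phi g u t == 0) || (y v * phi g v t == 0)) (bumps n).
Proof.
have := uniq_bumps n; rewrite uniq_pairwise; apply: (@sub_in_pairwise _ (mem (bumps n))); last exact: allss.
move=> u v un vn /= uv.
suff : phi g u t = 0 \/ phi g v t = 0.
  by case=> ->; rewrite mulr0 eqxx ?orbT.
have [|h|h] := @node_disjoint _ _ _ _ _ _ hT hO u v _ uv.
- by rewrite (size_mem_bumps un) (size_mem_bumps vn).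
- have [ht|ht] := leP (b (node u)) t; [left|right]; apply: (phi_out hT); [by right|left; lra].
- have [ht|ht] := leP (b (node v)) t; [right|left]; apply: (phi_out hT); [by right|left; lra].
Qed.

Lemma level_bound x n t k : (forall s, `|x s| <= k) ->
  `|level g x n t| <= k * amplitude n.
Proof.
move=> xk; rewrite /level normrM ger0_norm ?amplitude_ge0// mulrC ler_wpM2r ?amplitude_ge0//.
have [[-> _]|[u _ [-> _]]] := pairwise_single (pairwise_phi (fun u => x (label u)) n t).
  by rewrite normr0; exact: le_trans (xk [::]).
rewrite normrM; have /andP[p0 p1] := phi_bounds hT u t.
by rewrite -[k]mulr1 ler_pM// ger0_norm.
Qed.

Lemma level_diffE x n t t' : level g x n t' - level g x n t =
  \sum_(u <- bumps n) (amplitude n * x (label u) * phi g u t' -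
                       amplitude n * x (label u) * phi g u t).
Proof.
by rewrite /level -mulrBr -sumrB mulr_sumr; apply: eq_bigr => u _; rewrite mulrBr !mulrA.
Qed.

Lemma level_diff_sqr x n t t' : (level g x n t' - level g x n t) ^+ 2 <=
  2 * \sum_(u <- bumps n) (amplitude n * x (label u)) ^+ 2 * (phi g u t' - phi g u t) ^+ 2.
Proof.
rewrite level_diffE; apply: le_trans (sqr_sum_two _ _) _; [exact: pairwise_phi|exact: pairwise_phi|].
by rewrite ler_wpM2l//; apply: ler_sum => u _; rewrite -mulrBr exprMn.
Qed.

Lemma level_diff_abs x n t t' k : (forall s, `|x s| <= k) ->
  `|level g x n t' - level g x n t| <=
  amplitude n * k * \sum_(u <- bumps n) `|phi g u t' - phi g u t|.
Proof.
move=> xk; rewrite level_diffE; apply: le_trans (ler_norm_sum _ _ _) _.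
rewrite mulr_sumr; apply: ler_sum => u _.
by rewrite -mulrBr !normrM ger0_norm ?amplitude_ge0// ler_wpM2r// ler_wpM2l// amplitude_ge0.
Qed.

(** In the square of an increment of the sum of all levels, every cross term
pairs the total variation of a level with the much smaller amplitude of the later
ones, and on a single level at most two bumps see the increment. *)
Lemma almost_orthogonal x N P k : sorted <%R P -> (forall s, `|x s| <= k) ->
  qv (partial g x N) P <=
  2 * (\sum_(0 <= n < N) \sum_(u <- bumps n)
     (amplitude n * x (label u)) ^+ 2 * qv (phi g u) P) + 8 * k ^+ 2.
Proof.
move=> sP xk.
have k0 : 0 <= k by exact: le_trans (xk [::]).
pose r n := 4 * k * amplitude n.+1 : R.
pose y (i : nat) n := level g x n P`_i.+1 - level g x n P`_i.
have step1 : qv (partial g x N) P <= \sum_(i < (size P).-1)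
    \sum_(0 <= n < N) (y i n ^+ 2 + 2 * (`|y i n| * r n)).
  apply: ler_sum => i _; rewrite /partial -sumrB; apply: sqr_sum_tail => // n nN.
  apply: le_trans (ler_norm_sum _ _ _) _.
  apply: (@le_trans _ _ (\sum_(n.+1 <= j < N) 2 * k * amplitude j)).
    apply: ler_sum => j _; apply: le_trans (ler_normB _ _) _.
    by have := level_bound j P`_i.+1 xk; have := level_bound j P`_i xk; lra.
  rewrite -mulr_sumr; have := amplitude_tail (R := R) n.+1 N; rewrite /r => h.
  have : 2 * k * \sum_(n.+1 <= j < N) amplitude j <= 2 * k * (2 * amplitude n.+1).
    by rewrite ler_wpM2l// mulr_ge0.
  by lra.
apply: le_trans step1 _; rewrite exchange_big /=.
pose S n := \sum_(u <- bumps n) (amplitude n * x (label u)) ^+ 2 * qv (phi g u) P.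
apply: (@le_trans _ _ (\sum_(0 <= n < N) (2 * S n + 4 * k ^+ 2 * (2^-1) ^+ n))).
  apply: ler_sum => n _; rewrite big_split /=; apply: lerD.
    apply: (@le_trans _ _ (\sum_(i < (size P).-1) 2 * \sum_(u <- bumps n)
      (amplitude n * x (label u)) ^+ 2 * (phi g u P`_i.+1 - phi g u P`_i) ^+ 2)).
      by apply: ler_sum => i _; exact: level_diff_sqr.
    rewrite -mulr_sumr exchange_big /= ler_wpM2l//; apply: ler_sum => u _.
    by rewrite -mulr_sumr.
  rewrite -mulr_sumr -mulr_suml.
  have h : \sum_(i < (size P).-1) `|y i n| <=
      amplitude n * k * (2 * (size (bumps n))%:R).
    apply: (@le_trans _ _ (\sum_(i < (size P).-1) amplitude n * k *
       \sum_(u <- bumps n) `|phi g u P`_i.+1 - phi g u P`_i|)).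
      by apply: ler_sum => i _; exact: level_diff_abs.
    rewrite -mulr_sumr ler_wpM2l ?mulr_ge0 ?amplitude_ge0//.
    rewrite exchange_big /=.
    apply: (@le_trans _ _ (\sum_(u <- bumps n) 2)).
      by apply: ler_sum => u _; exact: phi_variation.
    by rewrite big_const_seq count_predT iter_addr_0 mulr_natr.
  have r0 : 0 <= r n by rewrite !mulr_ge0 ?amplitude_ge0.
  have := ler_wpM2r r0 h.
  set Y := \sum_(i < _) _ => hY.
  have : amplitude n * k * (2 * (size (bumps n))%:R) * r n * 2 = 4 * k ^+ 2 * 2^-1 ^+ n.
    rewrite /r (_ : _ * 2 = 16 * k ^+ 2 * ((size (bumps n))%:R * amplitude n ^+ 2) / 4 ^+ n.+1); last first.
      by rewrite /=; ring.
    rewrite size_bumps [4 ^+ n.+1]exprS.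
    have -> : (4 : R) ^+ n = 2 ^+ n * 2 ^+ n by rewrite -exprMn; congr (_ ^+ _); ring.
    by rewrite exprVn; field; rewrite expf_neq0.
  by lra.
rewrite big_split /= -!mulr_sumr lerD2l.
suff : \sum_(0 <= n < N) (2^-1 : R) ^+ n <= 2.
  by move=> h; have := ler_wpM2l (_ : 0 <= 4 * k ^+ 2) h; rewrite mulr_ge0 ?sqr_ge0// => /(_ isT); lra.
have h2 : \sum_(0 <= n < N) (2^-1 : R) ^+ n = 2 - 2 * 2^-1 ^+ N.
  elim: N => [|N IH]; first by rewrite big_geq// expr0; ring.
  by rewrite big_nat_recr//= IH exprS; field.
by rewrite h2; have : 0 <= (2^-1 : R) ^+ N; [rewrite exprn_ge0// invr_ge0|lra].
Qed.

End AlmostOrthogonality.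

(** * The upper estimate *)

Section Combinatorics.
Context {R : realType}.

(** Two steps of a partition cannot jump over the same interval. *)
Lemma sum_jumps_over (p q : R) (P : seq R) : p <= q -> sorted <%R P ->
  \sum_(i < (size P).-1) ((P`_i < p) && (q < P`_i.+1))%:R <=
  (~~ has (fun t => p <= t <= q) P)%:R :> R.
Proof.
move=> pq; case: P => [|t P]; first by rewrite big_ord0.
elim: P t => [|t' P IH] t; first by rewrite big_ord0 ler0n.
move=> /= /andP[tt' tP]; rewrite big_ord_recl /=.
have later : p <= t' ->
    \sum_(i < size P) (((t' :: P)`_i < p) && (q < (t' :: P)`_i.+1))%:R = 0 :> R.
  move=> pt'; rewrite big1// => i _; rewrite ltNge (_ : p <= _ = true)//.
  apply: (le_trans pt'); have : (t' :: P)`_i \in t' :: P by rewrite mem_nth//= ltnS ltnW.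
  rewrite inE => /predU1P[->//|iP].
  have /allP/(_ _ iP) : all (<=%R t') P.
    by apply: order_path_min le_trans _; apply: sub_path tP => u v /ltW.
  by [].
have [/andP[tp qt']|jump] := boolP ((t < p) && (q < t')).
  rewrite (_ : \sum_(i < _) _ = 0); last exact: (later (le_trans pq (ltW qt'))).
  rewrite addr0 ler_nat lt0b /=.
  have /allP tP' : all (<%R t') P by exact: order_path_min lt_trans tP.
  rewrite leNgt tp /= leNgt; rewrite (leNgt t') qt' andbF /=.
  by apply/hasPn => u /tP' tu; rewrite (leNgt u) (lt_trans qt' tu) andbF.
rewrite add0r negb_or -[X in ~~ X && _]/(p <= t <= q).
have [/andP[pt _]|nt] := boolP (p <= t <= q).
  by rewrite [X in X <= _](later (le_trans pt (ltW tt'))).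
exact: (IH _ tP).
Qed.

(** In the application [Q] selects the trapezoids that a jump moves: all but the
last one have a successor in [Q]. *)
Lemma sum_pairs (Q : pred nat) (C : nat -> nat) K :
  (forall i j, (i < j < K)%N -> Q i -> Q j -> (0 < C i)%N) ->
  (\sum_(i < K) Q i <= 1 + \sum_(i < K) C i)%N.
Proof.
elim: K => [|K IH] QC; first by rewrite !big_ord0.
rewrite !big_ord_recr /=; have [QK|_] := boolP (Q K).
  rewrite addnC leq_add2l; apply: leq_trans (leq_addr _ _); apply: leq_sum => i _.
  by case: (boolP (Q i)) => // Qi; apply: QC Qi QK; rewrite ltnSn andbT.
rewrite addn0 addnA; apply: leq_trans (leq_addr _ _); apply: IH => i j /andP[ij jK].
by apply: QC; rewrite ij ltnS ltnW.
Qed.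

Fixpoint words n : seq (seq bool) :=
  if n is m.+1 then [seq rcons s i | s <- words m, i <- [:: false; true]] else [:: [::]].

Lemma wordsS n : words n.+1 = [seq rcons s i | s <- words n, i <- [:: false; true]].
Proof. by []. Qed.

Lemma uniq_words n : uniq (words n).
Proof.
elim: n => // n IH; apply: (@allpairs_uniq _ _ _ rcons) => //.
by move=> [s i] [r j] _ _ /= /rcons_inj[-> ->].
Qed.

Lemma mem_words s : s \in words (size s).
Proof.
elim/last_ind: s => [|s i IH]; first by rewrite mem_head.
rewrite size_rcons; apply: (allpairs_f rcons) => //.
by case: i; rewrite !inE.
Qed.

Lemma size_mem_words n s : s \in words n -> size s = n.
Proof.
elim: n s => [|n IH] s; first by rewrite inE => /eqP ->.
by rewrite wordsS => /allpairsP[[r i] /= [/IH <- _ ->]]; rewrite size_rcons.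
Qed.

Lemma sum_wordsS (F : seq bool -> R) n :
  \sum_(s <- words n.+1) F s =
  \sum_(s <- words n) (F (rcons s false) + F (rcons s true)).
Proof.
rewrite wordsS big_allpairs_dep; apply: eq_bigr => s _.
by rewrite !big_cons big_nil /= addr0.
Qed.

Lemma sum_by_label (F : seq letter -> R) n :
  \sum_(u <- bumps n) F u =
  \sum_(s <- words n) \sum_(u <- bumps n | label u == s) F u.
Proof.
under [RHS]eq_bigr do rewrite big_mkcond.
rewrite exchange_big /= big_seq [RHS]big_seq; apply: eq_bigr => u un.
rewrite (bigD1_seq (label u)) ?uniq_words ?eqxx//=; last first.
  by rewrite -(size_mem_bumps un) -size_label mem_words.
by rewrite big1 ?addr0// => s; rewrite eq_sym => /negbTE ->.
Qed.

Definition antichain_seq (l : seq (seq bool)) : Prop :=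
  {in l &, forall s r, prefix s r -> s = r}.

(** The largest quadratic sum of [x] over an antichain of descendants of [s] less
than [k] levels below [s]. *)
Fixpoint antichain_max (x : seq bool -> R) k s : R :=
  if k is k'.+1 then Num.max (x s ^+ 2)
    (antichain_max x k' (rcons s false) + antichain_max x k' (rcons s true)) else 0.

Lemma antichain_max_ge0 x k s : 0 <= antichain_max x k s.
Proof. by case: k => //= k; rewrite le_max sqr_ge0. Qed.

Lemma antichain_maxP x k s : exists l,
  [/\ uniq l, antichain_seq l, all (prefix s) l
    & antichain_max x k s = \sum_(r <- l) x r ^+ 2].
Proof.
elim: k s => [|k IH] s; first by exists [::]; rewrite big_nil.
rewrite /=; have [_|_] := leP (x s ^+ 2); last first.
  exists [:: s]; rewrite big_seq1; split => //=; last by rewrite prefix_refl.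
  by move=> r r'; rewrite !inE => /eqP -> /eqP ->.
have [l0 [u0 a0 p0 ->]] := IH (rcons s false); have [l1 [u1 a1 p1 ->]] := IH (rcons s true).
have incomparable i r r' : prefix (rcons s i) r -> prefix (rcons s (~~ i)) r' ->
    ~~ prefix r r'.
  move=> /prefixP[w ->] /prefixP[w' ->]; rewrite !cat_rcons.
  by elim: s {IH u0 a0 p0 u1 a1 p1} => [|j s IH] //=; [case: i|rewrite eqxx].
exists (l0 ++ l1); split; last by rewrite big_cat.
- rewrite cat_uniq u0 u1 andbT /=; apply/hasPn => r /(allP p1) r1.
  apply/negP => /(allP p0) r0; have := @incomparable false r r r0 r1.
  by rewrite prefix_refl.
- move=> r r'; rewrite !mem_cat => /orP[rl|rl] /orP[rl'|rl'].
  + exact: a0.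
  + by rewrite (negbTE (@incomparable false _ _ (allP p0 _ rl) (allP p1 _ rl'))).
  + by rewrite (negbTE (@incomparable true _ _ (allP p1 _ rl) (allP p0 _ rl'))).
  + exact: a1.
- rewrite all_cat; apply/andP; split; apply/allP => r /(allP _) h.
    by apply: prefix_trans (prefix_rcons s false) (h _ p0).
  by apply: prefix_trans (prefix_rcons s true) (h _ p1).
Qed.

(** A mass [A] that decreases along the tree is shared between antichains: what
is lost at [s] is charged to [x s], the rest to the two successors. *)
Lemma antichain_budget (A x : seq bool -> R) N :
  (forall s, 0 <= A s) -> (forall s i, A (rcons s i) <= A s) ->
  \sum_(0 <= n < N) \sum_(s <- words n)
    x s ^+ 2 * (A s - Num.max (A (rcons s false)) (A (rcons s true))) <=
  A [::] * antichain_max x N [::].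
Proof.
move=> A0 AS.
pose Phi n := \sum_(s <- words n) A s * antichain_max x (N - n) s.
have -> : A [::] * antichain_max x N [::] = Phi 0%N by rewrite /Phi big_seq1 subn0.
suff H k : (k <= N)%N -> \sum_(0 <= n < k) \sum_(s <- words n)
    x s ^+ 2 * (A s - Num.max (A (rcons s false)) (A (rcons s true))) + Phi k <= Phi 0%N.
  apply: le_trans (H N (leqnn N)); rewrite lerDl; apply: sumr_ge0 => s _.
  by rewrite mulr_ge0 ?antichain_max_ge0.
elim: k => [|k IH] kN; first by rewrite big_geq// add0r.
apply: le_trans (IH (ltnW kN)); rewrite big_nat_recr//= -addrA lerD2l.
have E : (N - k = (N - k.+1).+1)%N by rewrite subnSK.
rewrite /Phi sum_wordsS -big_split E; apply: ler_sum => s _ /=.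
have := antichain_max_ge0 x (N - k.+1) (rcons s false).
have := antichain_max_ge0 x (N - k.+1) (rcons s true).
set M0 := antichain_max _ _ (rcons s false); set M1 := antichain_max _ _ (rcons s true).
move=> m1 m0; set X := x s ^+ 2; set m := Num.max (A _) (A _).
set M := Num.max X _.
have [XM MM] : X <= M /\ M0 + M1 <= M by rewrite !le_max !lexx orbT.
have [h0 h1 h2] : [/\ A (rcons s false) <= m, A (rcons s true) <= m & m <= A s].
  by rewrite /m !le_max ge_max !lexx orbT !AS.
have := ler_wpM2r m0 h0; have := ler_wpM2r m1 h1.
have m_ge0 : 0 <= m by rewrite /m le_max A0.
have := ler_wpM2l m_ge0 MM.
have dm : 0 <= A s - m by rewrite subr_ge0.
by have := ler_wpM2r dm XM; lra.
Qed.

End Combinatorics.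

Section UpperEstimate.
Context {R : realType}.
Variables (a b c d : seq bool -> R) (g : seq bool -> R -> R).
Hypothesis hT : tree_family_of_trapezoids a b c d g.
Hypothesis hO : forall s, b (rcons s false) < a (rcons s true).
Implicit Types (t : R) (P : seq R) (x : seq bool -> R).

Definition hits P s : bool := has (fun t => a s <= t <= b s) P.

Lemma hits_sub P s r : a s <= a r -> b r <= b s -> hits P r -> hits P s.
Proof. by move=> h1 h2; apply: sub_has => t /andP[t1 t2]; apply/andP; split; lra. Qed.

Definition missed P u : R :=
  \sum_(i < chain_length (size u)) \sum_(sd : bool) (~~ hits P (side u i sd))%:R.

Lemma missed_ge0 P u : 0 <= missed P u.
Proof. by apply: sumr_ge0 => i _; apply: sumr_ge0 => sd _; rewrite ler0n. Qed.

Let g_moves s t t' : t < t' -> g s t' - g s t != 0 ->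
  [/\ a s < t', t < b s & t < c s \/ d s < t'].
Proof.
move=> tt' gs; have [l1 l2 l3 l4] := tree_lt hT s; split.
- rewrite ltNge; apply/negP => h; move/eqP: gs; apply.
  by rewrite !(tree_g0 hT) ?subrr//; left; lra.
- rewrite ltNge; apply/negP => h; move/eqP: gs; apply.
  by rewrite !(tree_g0 hT) ?subrr//; right; lra.
- have [h|h] := ltP t (c s); first by left.
  have [h'|h'] := ltP (d s) t'; first by right.
  by move/eqP: gs; case; rewrite !(tree_g1 hT) ?subrr//; apply/andP; split; lra.
Qed.

(** An increment of [phi u] that moves [L] of the trapezoids of the chain jumps
over a side of each of them but the innermost one. *)
Lemma phi_jump u t t' : t < t' ->
  (phi g u t' - phi g u t) ^+ 2 <=
  (`|phi g u t' - phi g u t| + \sum_(i < chain_length (size u)) \sum_(sd : bool)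
     ((t < a (side u i sd)) && (b (side u i sd) < t'))%:R) / (chain_length (size u))%:R.
Proof.
move=> tt'; set K := chain_length (size u); set D := phi g u t' - phi g u t.
have K0 : 0 < K%:R :> R by rewrite ltr0n chain_length_gt0.
pose cover i sd := (t < a (side u i sd)) && (b (side u i sd) < t').
pose Q i := g (chain u i) t' - g (chain u i) t != 0.
have step1 : `|D| <= (\sum_(i < K) Q i)%:R / K%:R.
  rewrite /D /phi -/K -mulrBr -sumrB normrM ger0_norm ?invr_ge0 ?ler0n// mulrC.
  rewrite ler_wpM2r ?invr_ge0 ?ler0n// natr_sum.
  apply: le_trans (ler_norm_sum _ _ _) _; apply: ler_sum => i _.
  have [_|] := boolP (Q i); last by rewrite /Q negbK => /eqP ->; rewrite normr0.
  have /andP[? ?] := tree_g_bounds hT (chain u i) t.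
  have /andP[? ?] := tree_g_bounds hT (chain u i) t'.
  by rewrite ler_norml /=; apply/andP; split; lra.
have step2 : (\sum_(i < K) Q i <= 1 + \sum_(i < K) \sum_(sd : bool) cover i sd)%N.
  apply: (sum_pairs (C := fun i => \sum_(sd : bool) cover i sd)%N) => i j /andP[ij jK] Qi Qj.
  have [i1 i2 i3] := g_moves tt' Qi; have [j1 j2 _] := g_moves tt' Qj.
  have [m1 m2 m3 m4] := chain_mono hT u ij.
  rewrite big_bool /= /cover; case: i3 => h.
    have [s1 s2] := side_in hT u i false; have s3 := side_left hT hO u i.
    rewrite addn_gt0; apply/orP; right; rewrite lt0b; apply/andP; split; lra.
  have [s1 s2] := side_in hT u i true; have s3 := side_right hO u i.
  rewrite addn_gt0; apply/orP; left; rewrite lt0b; apply/andP; split; lra.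
have D1 : `|D| <= 1.
  have /andP[? ?] := phi_bounds hT u t; have /andP[? ?] := phi_bounds hT u t'.
  by rewrite ler_norml /D; apply/andP; split; lra.
set C : R := \sum_(i < K) _.
have CE : C = (\sum_(i < K) \sum_(sd : bool) cover i sd)%N%:R.
  by rewrite natr_sum; apply: eq_bigr => i _; rewrite natr_sum.
have C0 : 0 <= C by rewrite CE ler0n.
have step3 : `|D| <= (1 + C) / K%:R.
  apply: le_trans step1 _; rewrite ler_wpM2r ?invr_ge0 ?ler0n//.
  by rewrite CE -[X in X + _]/(1%:R) -natrD ler_nat.
rewrite -real_normK ?num_real// expr2.
apply: (@le_trans _ _ (`|D| * ((1 + C) / K%:R))); first by rewrite ler_wpM2l.
rewrite mulrA ler_wpM2r ?invr_ge0 ?ler0n// mulrDr mulr1 lerD2l.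
by rewrite ler_piMl.
Qed.

(** Adding up the jumps: every missed side is jumped over once, and the remaining
terms are controlled by the total variation. *)
Lemma qv_phi u P : sorted <%R P ->
  qv (phi g u) P <=
  (hits P (node u))%:R * ((missed P u + 2) / (chain_length (size u))%:R).
Proof.
move=> sP; have [hit|/hasPn nohit] := boolP (hits P (node u)); last first.
  rewrite mul0r (@qv_eq _ _ (fun=> 0)); last first.
    move=> t /nohit; rewrite negb_and -!ltNge => /orP h; apply: (phi_out hT).
    by case: h => ?; [left|right]; lra.
  by rewrite /qv big1// => i _; rewrite subrr expr0n.
rewrite mul1r /qv; set K := chain_length _.
have K0 : 0 <= K%:R^-1 :> R by rewrite invr_ge0 ler0n.
have Plt (i : 'I_(size P).-1) : P`_i < P`_i.+1.
  have iP : (i.+1 < size P)%N by case: (P) i => [|t' P'] [].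
  by apply/(sortedP 0).
apply: le_trans (_ : \sum_(i < (size P).-1)
  (`|phi g u P`_i.+1 - phi g u P`_i| + \sum_(j < K) \sum_(sd : bool)
     ((P`_i < a (side u j sd)) && (b (side u j sd) < P`_i.+1))%:R) / K%:R <= _).
  by apply: ler_sum => i _; exact: phi_jump.
rewrite -mulr_suml ler_wpM2r// big_split /= addrC; apply: lerD; last exact: phi_variation.
rewrite exchange_big /=; apply: ler_sum => j _; rewrite exchange_big /=.
apply: ler_sum => sd _; apply: sum_jumps_over => //.
by have [_ _ _ /ltW] := tree_lt hT (side u j sd).
Qed.

Definition hit_mass P s : R :=
  \sum_(u <- bumps (size s) | label u == s) amplitude (size s) ^+ 2 * (hits P (node u))%:R.

Lemma hit_mass_ge0 P s : 0 <= hit_mass P s.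
Proof. by apply: sumr_ge0 => u _; rewrite mulr_ge0 ?sqr_ge0. Qed.

Lemma hit_mass_le1 P s : hit_mass P s <= 1.
Proof.
rewrite -[X in _ <= X](sum_amplitude s); apply: ler_sum => u _.
by rewrite ler_piMr ?sqr_ge0// lern1 leq_b1.
Qed.

(** On a missed side of a bump [u] labelled [s], the partition misses one of the
[2 * chain_length (size s)] bumps above [u] labelled [rcons s i]. *)
Lemma missed_budget P s i :
  \sum_(u <- bumps (size s) | label u == s) amplitude (size s) ^+ 2 *
     ((hits P (node u))%:R * (missed P u / (chain_length (size s))%:R)) <=
  2 * (hit_mass P s - hit_mass P (rcons s i)).
Proof.
rewrite /hit_mass size_rcons sum_bumpsS -sumrB mulr_sumr.
rewrite big_seq_cond [leRHS]big_seq_cond; apply: ler_sum => u /andP[us _].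
rewrite -(amplitudeS_sqr (size s)); set K := chain_length _; set A := amplitude _ ^+ 2.
have su : size u = size s by exact: size_mem_bumps us.
have A0 : 0 <= A by rewrite sqr_ge0.
have K0 : K%:R != 0 :> R by rewrite pnatr_eq0 -lt0n chain_length_gt0.
suff h : \sum_(j < K) \sum_(sd : bool)
    A * (hits P (node (rcons u (j : nat, (sd, i)))))%:R <=
    A * ((hits P (node u))%:R * (2 * K%:R - missed P u)).
  have -> : A * (2 * K%:R) * ((hits P (node u))%:R * (missed P u / K%:R)) =
      2 * (A * (hits P (node u))%:R * missed P u) by field.
  by rewrite ler_pM2l//; lra.
under eq_bigr do rewrite -mulr_sumr.
rewrite -mulr_sumr ler_wpM2l//.
have [hu|hu] := boolP (hits P (node u)); last first.
  rewrite mul0r big1// => j _; rewrite big1// => sd _.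
  suff /negbTE -> : ~~ hits P (node (rcons u (j : nat, (sd, i)))) by [].
  apply: contra hu.
  have [h1 h2] := node_desc hT u [:: (j : nat, (sd, i))].
  by rewrite cats1 in h1 h2; exact: hits_sub.
rewrite mul1r lerBrDr /missed su -/K -big_split /=.
rewrite (_ : 2 * K%:R = \sum_(j < K) 2); last by rewrite sumr_const card_ord mulr_natr.
apply: ler_sum => j _; rewrite !big_bool /=.
have H sd : (hits P (node (rcons u (j : nat, (sd, i)))))%:R +
    (~~ hits P (side u j sd))%:R <= 1 :> R.
  case: (boolP (hits P (side u j sd))) => hs; first by rewrite addr0 lern1 leq_b1.
  suff /negbTE -> : ~~ hits P (node (rcons u (j : nat, (sd, i)))) by rewrite add0r.
  apply: contra hs.
  have [h1 h2] := child_in hT u (j : nat, (sd, i)); rewrite /= in h1 h2.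
  have [l1 l2 l3 l4] := tree_lt hT (side u j sd).
  by apply: hits_sub; lra.
by have := H true; have := H false; lra.
Qed.

Lemma hit_mass_rcons P s i : hit_mass P (rcons s i) <= hit_mass P s.
Proof.
have := missed_budget P s i; set S := \sum_(_ <- _ | _) _ => h.
have : 0 <= S; last by lra.
by apply: sumr_ge0 => u _; rewrite mulr_ge0 ?sqr_ge0// mulr_ge0// mulr_ge0 ?missed_ge0.
Qed.

(** The factor 4 leaves room for the constants: 4 from the antichains, 1 from the
terms [2 / chain_length n] and 8 from the cross terms. *)
Theorem upper_estimate x k N P : 0 <= k -> sorted <%R P ->
  (forall l, uniq l -> antichain_seq l -> \sum_(s <- l) x s ^+ 2 <= k ^+ 2) ->
  qv (partial g x N) P <= (4 * k) ^+ 2.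
Proof.
move=> k0 sP xk.
have x1 s : x s ^+ 2 <= k ^+ 2.
  have := xk [:: s]; rewrite big_seq1; apply => // r r'.
  by rewrite !inE => /eqP -> /eqP ->.
have xk1 s : `|x s| <= k by rewrite -(ler_sqr)// ?nnegrE// real_normK ?num_real.
apply: le_trans (almost_orthogonal hT hO N sP xk1) _.
pose A := hit_mass P; pose del s := A s - Num.max (A (rcons s false)) (A (rcons s true)).
have main : \sum_(0 <= n < N) \sum_(s <- words n) x s ^+ 2 * del s <= k ^+ 2.
  apply: le_trans (antichain_budget x N (hit_mass_ge0 P) (hit_mass_rcons P)) _.
  have [l [ul al _ ->]] := antichain_maxP x N [::].
  apply: le_trans (xk l ul al).
  by rewrite ler_piMl ?hit_mass_le1// sumr_ge0// => s _; rewrite sqr_ge0.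
suff h : \sum_(0 <= n < N) \sum_(u <- bumps n)
   (amplitude n * x (label u)) ^+ 2 * qv (phi g u) P <=
   2 * (\sum_(0 <= n < N) \sum_(s <- words n) x s ^+ 2 * del s) +
   \sum_(0 <= n < N) k ^+ 2 * 4^-1 * 2^-1 ^+ n.
  have h2 : \sum_(0 <= n < N) (2^-1 : R) ^+ n = 2 - 2 * 2^-1 ^+ N.
    elim: N {main h} => [|N IH]; first by rewrite big_geq// expr0; ring.
    by rewrite big_nat_recr//= IH exprS; field.
  have h3 : \sum_(0 <= n < N) k ^+ 2 * 4^-1 * 2^-1 ^+ n <= k ^+ 2 * 4^-1 * 2.
    rewrite -mulr_sumr h2 ler_wpM2l ?mulr_ge0 ?sqr_ge0// lerBlDr lerDl.
    by rewrite mulr_ge0// exprn_ge0// invr_ge0.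
  move: h h3 main; set S := \sum_(0 <= n < N) _.
  set S1 := \sum_(0 <= n < N) _; set S2 := \sum_(0 <= n < N) _.
  by rewrite exprMn; have := sqr_ge0 k; lra.
rewrite mulr_sumr -big_split /=; apply: ler_sum => n _.
pose K : R := (chain_length n)%:R.
have K0 : 0 < K by rewrite ltr0n chain_length_gt0.
apply: (@le_trans _ _ (\sum_(u <- bumps n) (x (label u) ^+ 2 * (amplitude n ^+ 2 *
    ((hits P (node u))%:R * (missed P u / K))) + k ^+ 2 * amplitude n ^+ 2 * (2 / K)))).
  rewrite big_seq [leRHS]big_seq; apply: ler_sum => u un.
  have := qv_phi u sP; rewrite (size_mem_bumps un) -/K => hq.
  have A0 : 0 <= amplitude n ^+ 2 :> R by rewrite sqr_ge0.
  apply: (@le_trans _ _ (amplitude n ^+ 2 * x (label u) ^+ 2 *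
    ((hits P (node u))%:R * ((missed P u + 2) / K)))).
    by rewrite exprMn ler_wpM2l// mulr_ge0// sqr_ge0.
  rewrite [(missed P u + 2) / K]mulrDl mulrDr mulrDr; apply: lerD.
    by rewrite le_eqVlt; apply/orP; left; apply/eqP; ring.
  rewrite mulrA ler_wpM2r ?divr_ge0 ?(ltW K0)// [amplitude n ^+ 2 * _]mulrC -mulrA.
  apply: ler_pM; rewrite ?sqr_ge0 ?x1//; first by rewrite mulr_ge0.
  by rewrite ler_piMr// lern1 leq_b1.
rewrite big_split /=; apply: lerD.
  rewrite sum_by_label mulr_sumr big_seq [leRHS]big_seq; apply: ler_sum => s sn.
  have ss := size_mem_words sn.
  rewrite (eq_bigr (fun u => x s ^+ 2 * (amplitude n ^+ 2 *
    ((hits P (node u))%:R * (missed P u / K))))); last by move=> u /eqP ->.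
  rewrite -mulr_sumr mulrCA ler_wpM2l ?sqr_ge0// /del.
  have := missed_budget P s false; have := missed_budget P s true; rewrite ss -/K -!/(A _).
  by rewrite /Num.max; case: ifP.
rewrite big_const_seq count_predT iter_addr_0 -[leLHS]mulr_natr.
have -> : k ^+ 2 * amplitude n ^+ 2 * (2 / K) * (size (bumps n))%:R =
   2 * k ^+ 2 * ((size (bumps n))%:R * amplitude n ^+ 2) / K by ring.
rewrite size_bumps ler_pdivrMr// /K natrM natrX exprVn.
have -> : (16 : R) ^+ n = 2 ^+ n * 2 ^+ n * 4 ^+ n.
  by rewrite -!exprMn; congr (_ ^+ _); ring.
have e1 : 1 <= (4 : R) ^+ n by rewrite exprn_ege1// ler1n.
have e2 : 0 < (2 : R) ^+ n by rewrite exprn_gt0.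
have -> : k ^+ 2 / 4 / 2 ^+ n * (8 * (2 ^+ n * 2 ^+ n * 4 ^+ n)) =
  2 * k ^+ 2 * 2 ^+ n * 4 ^+ n by field; rewrite lt0r_neq0.
by rewrite ler_peMr// mulr_ge0 ?(ltW e2)// mulr_ge0 ?sqr_ge0.
Qed.

End UpperEstimate.

(** * The norms and the spaces *)

Section Norms.
Context {R : realType}.
Implicit Types (f h : R -> R) (P : seq R) (x : seq bool -> R).

Lemma V2_norm_le f k : 0 <= k ->
  (forall P, partition_in `[0, 1] P -> qv f P <= k ^+ 2) -> (V2_norm f <= k%:E)%E.
Proof.
move=> k0 fk; apply: ge_ereal_sup => _ [P PI <-].
by rewrite lee_fin v2_le// fk.
Qed.

Lemma V2_norm_ge0 f : (0 <= V2_norm f)%E.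
Proof.
apply: ereal_sup_ge; exists (v2 f [:: 0; 1])%:E; last by rewrite lee_fin v2_ge0.
exists [:: 0; 1] => //; split => //=; first by rewrite ltr01.
by move=> t; rewrite in_cons mem_seq1 => /orP[]/eqP ->; rewrite /= in_itv /= ?lexx ?ler01.
Qed.

Lemma V2_norm_qv f k P : (V2_norm f <= k%:E)%E -> partition_in `[0, 1] P ->
  qv f P <= k ^+ 2.
Proof.
move=> fk PI; have k0 : 0 <= k by rewrite -lee_fin (le_trans (V2_norm_ge0 f)).
rewrite -v2_le// -lee_fin; apply: le_trans fk; apply: ereal_sup_ubound.
by exists P.
Qed.

Lemma partition_short (delta : R) : 0 < delta ->
  exists P, [/\ partition_in `[0, 1] P & mesh P < delta].
Proof.
move=> d0; pose y := Num.min (delta / 2) 1.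
have [y0 y1 yd] : [/\ 0 < y, y <= 1 & y < delta].
  by rewrite /y lt_min gt_min ge_min lexx orbT ltr01 divr_gt0//; split => //; apply/orP; left; lra.
exists [:: 0; y]; split; last by rewrite mesh_cons2 mesh1 gt_max subr0 yd.
split => //=; first by rewrite y0.
by move=> t; rewrite in_cons mem_seq1 => /orP[]/eqP ->; rewrite /= in_itv /= ?lexx ?ler01 ?(ltW y0).
Qed.

(** The condition that defines [V20] inside [V2], stated with quadratic sums. *)
Definition small_scale f : Prop := forall e : R, 0 < e ->
  exists2 delta : R, 0 < delta &
    forall P, partition_in `[0, 1] P -> mesh P < delta -> qv f P <= e.

Lemma V20P f : V20 f <-> V2 f /\ small_scale f.
Proof.
split=> [[V2f f0]|[V2f f0]]; split => //.
- move=> e e0; have se0 : 0 < Num.sqrt e by rewrite sqrtr_gt0.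
  have := f0; move=> /fine_cvgP[fin /cvgrPdist_lt/(_ _ se0) small].
  have [delta [d0 [fd sd]]] : exists delta : R, 0 < delta /\
      (ereal_sup [set (v2 f P)%:E | P in
         [set P | partition_in `[0, 1] P /\ mesh P < delta]] \is a fin_num /\
      `|0 - fine (ereal_sup [set (v2 f P)%:E | P in
         [set P | partition_in `[0, 1] P /\ mesh P < delta]])| < Num.sqrt e).
    near (0 : R)^'+ => delta; exists delta; split => //; split; near: delta => //.
  exists delta => // P PI Pd; rewrite -[e]sqr_sqrtr ?(ltW e0)// -v2_le ?sqrtr_ge0//.
  apply: le_trans (ltW sd); rewrite sub0r normrN; apply: le_trans (ler_norm _).
  rewrite -lee_fin fineK//; apply: ereal_sup_ubound; by exists P.
- apply/fine_cvgP; split.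
    have [delta d0 fd] := f0 1 ltr01; near=> r.
    have rd : r < delta by near: r; exact: nbhs_right_lt.
    have r0 : 0 < r by near: r; exact: nbhs_right_gt.
    rewrite fin_numElt; apply/andP; split.
      have [P PI] := partition_short r0.
      apply: lt_le_trans (ltNyr (v2 f P)) _; apply: ereal_sup_ubound; by exists P.
    apply: le_lt_trans (ltry (1 : R)); apply: ge_ereal_sup => _ [P [PI Pr] <-].
    by rewrite lee_fin v2_le// expr1n fd// (lt_trans Pr).
  apply/cvgrPdist_le => e e0.
  have [delta d0 fd] := f0 (e ^+ 2) (exprn_gt0 _ e0); near=> r.
  have rd : r < delta by near: r; exact: nbhs_right_lt.
  have r0 : 0 < r by near: r; exact: nbhs_right_gt.
  rewrite sub0r normrN.
  have [P PI] := partition_short r0.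
  have h0 : (0 <= ereal_sup [set (v2 f P)%:E | P in
         [set P | partition_in `[0%R, 1%R] P /\ (mesh P < r)%R]])%E.
    by apply: ereal_sup_ge; exists (v2 f P)%:E; [exists P|rewrite lee_fin v2_ge0].
  have h1 : (ereal_sup [set (v2 f P)%:E | P in
         [set P | partition_in `[0%R, 1%R] P /\ (mesh P < r)%R]] <= e%:E)%E.
    apply: ge_ereal_sup => _ [Q [QI Qr] <-].
    by rewrite lee_fin v2_le ?(ltW e0)// fd// (lt_trans Qr).
  by rewrite ger0_norm ?fine_ge0// -lee_fin fineK// (fin_numElt _) (lt_le_trans _ h0)// (le_lt_trans h1)// ltry.
Unshelve. all: by end_near.
Qed.

Lemma qv_lipschitz f k P : 0 <= k -> (forall s t, `|f s - f t| <= k * `|s - t|) ->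
  partition_in `[0, 1] P -> qv f P <= k ^+ 2 * mesh P.
Proof.
move=> k0 fk [sP Ps PI]; rewrite /qv.
have Plt (i : 'I_(size P).-1) : P`_i < P`_i.+1.
  have iP : (i.+1 < size P)%N by case: (P) i => [|t' P'] [].
  by apply/(sortedP 0).
have m0 : 0 <= mesh P by exact: mesh_ge0.
apply: (@le_trans _ _ (\sum_(i < (size P).-1) (k ^+ 2 * mesh P) * (P`_i.+1 - P`_i))).
  apply: ler_sum => i _; rewrite -real_normK ?num_real//.
  have d0 : 0 < P`_i.+1 - P`_i by rewrite subr_gt0.
  apply: (@le_trans _ _ ((k * (P`_i.+1 - P`_i)) ^+ 2)).
    by rewrite ler_sqr ?nnegrE ?mulr_ge0 ?(ltW d0)// -[X in _ <= k * X](gtr0_norm d0) fk.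
  rewrite exprMn -mulrA ler_wpM2l ?sqr_ge0// expr2 ler_wpM2r ?(ltW d0)//.
  rewrite /mesh; exact: (le_bigmax _ (fun i : 'I_(size P).-1 => P`_i.+1 - P`_i)).
rewrite -mulr_sumr -[X in _ <= X]mulr1 ler_wpM2l ?mulr_ge0 ?sqr_ge0//.
have -> : \sum_(i < (size P).-1) (P`_i.+1 - P`_i) = P`_(size P).-1 - P`_0.
  by rewrite -(big_mkord xpredT (fun i => P`_i.+1 - P`_i)) telescope_sumr.
have := PI P`_(size P).-1; have := PI P`_0; rewrite !mem_nth ?(ltnW sP) ?ltn_predL ?(ltnW sP)//.
move=> /(_ isT) + /(_ isT); rewrite /= !in_itv /= => /andP[? ?] /andP[? ?].
by lra.
Qed.

Lemma lipschitz_V20 f : (forall t, ~ `[0, 1]%classic t -> f t = 0) -> f 0 = 0 ->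
  lipschitz1 f -> V20 f.
Proof.
move=> fout f0 [k k0 fk]; apply/V20P; split.
  split => //; apply: (@le_lt_trans _ _ k%:E); last exact: ltry.
  apply: V2_norm_le => // P PI; apply: le_trans (qv_lipschitz k0 fk PI) _.
  rewrite ler_piMr ?sqr_ge0// /mesh; apply: bigmax_le => // i _.
  have [sP _ {}PI] := PI.
  have iP : (i.+1 < size P)%N by case: (P) i => [|t' P'] [].
  have := PI _ (mem_nth 0 iP); have := PI _ (mem_nth 0 (ltnW iP)).
  by rewrite /= !in_itv /= => /andP[? ?] /andP[? ?]; lra.
move=> e e0; exists (e / (k ^+ 2 + 1)).
  by rewrite divr_gt0// ltr_wpDl ?sqr_ge0.
move=> P PI Pm; apply: le_trans (qv_lipschitz k0 fk PI) _.
have k1 : 0 < k ^+ 2 + 1 by rewrite ltr_wpDl ?sqr_ge0.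
move: Pm; rewrite ltr_pdivlMr// => Pm.
by have := mesh_ge0 P; lra.
Qed.

Lemma small_scale_closed f :
  (forall e : R, 0 < e -> exists2 h, small_scale h &
     (V2_norm (fun t => f t - h t)%R <= e%:E)%E) -> small_scale f.
Proof.
move=> fh e e0; pose r := Num.sqrt (e / 4).
have r2 : r ^+ 2 = e / 4 by rewrite sqr_sqrtr// divr_ge0// ltW.
have r0 : 0 < r by rewrite sqrtr_gt0 divr_gt0.
have [h hs hf] := fh r r0.
have [delta d0 hd] := hs (e / 4) (divr_gt0 e0 (ltr0Sn _ 3)).
exists delta => // P PI Pd; have := hd P PI Pd; have := V2_norm_qv hf PI; rewrite r2.
have := qvD_le (fun t => f t - h t) h P.
rewrite (@qv_eq _ (fun t => f t - h t + h t) f); last by move=> t _ /=; rewrite subrK.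
by lra.
Qed.

(** Equal values of [e] are grouped, as a linear combination has one coefficient
for each index. *)
Lemma linear_span_sum (I : eqType) (J : Type) (g : I -> R -> R) (s : seq J)
    (k : J -> R) (e : J -> I) :
  linear_span g (fun t => \sum_(j <- s) k j * g (e j) t).
Proof.
pose l := undup [seq e j | j <- s].
exists l, (fun i => \sum_(j <- s | e j == i) k j).
have : all (fun j => e j \in l) s.
  suff : all [in [seq e j | j <- s]] [seq e j | j <- s].
    by rewrite all_map; apply: sub_all => j /=; rewrite mem_undup.
  exact: allss.
have : uniq l by rewrite undup_uniq.
move: l => l ul els; apply/funext => t; elim: s els => [_|j s IH /= /andP[jl els]].
  by rewrite big_nil big1// => i _; rewrite big_nil mul0r.
rewrite big_cons IH// (bigD1_seq (e j) jl ul)//= [in RHS](bigD1_seq (e j) jl ul)//=.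
rewrite big_cons eqxx mulrDl addrA; congr (_ + _).
by apply: eq_bigr => i; rewrite eq_sym => ij; rewrite big_cons (negbTE ij).
Qed.

Lemma S2_norm_seq x k l : (S2_norm x <= k%:E)%E -> uniq l -> antichain_seq l ->
  \sum_(s <- l) x s ^+ 2 <= k ^+ 2.
Proof.
move=> xk ul al.
have : (sqrte (\esum_(s in [set` l]) (x s ^+ 2)%:E) <= k%:E)%E.
  apply: le_trans xk; apply: ereal_sup_ubound; exists [set` l] => //.
rewrite esum_fset; last 2 first.
- exact: finite_seq.
- by move=> s _; rewrite lee_fin sqr_ge0.
rewrite -fsbig_seq// sumEFin /= lee_fin.
move=> h; have k0 : 0 <= k by apply: le_trans h; exact: sqrtr_ge0.
move: h; rewrite -ler_sqr ?nnegrE ?sqrtr_ge0// sqr_sqrtr//.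
by apply: sumr_ge0 => s _; exact: sqr_ge0.
Qed.

Lemma S2_norm_le x k : 0 <= k ->
  (forall l, uniq l -> antichain_seq l -> \sum_(s <- l) x s ^+ 2 <= k ^+ 2) ->
  (S2_norm x <= k%:E)%E.
Proof.
move=> k0 xk; apply: ge_ereal_sup => _ [A antiA <-].
rewrite (_ : k%:E = sqrte (k ^+ 2)%:E); last by rewrite /= sqrtr_sqr ger0_norm.
rewrite lee_sqrt ?lee_fin ?sqr_ge0//; apply: ge_ereal_sup => _ [X [finX XA] <-].
rewrite fsbig_finite//= sumEFin lee_fin; apply: xk; first exact: finmap.fset_uniq.
by move=> s r; rewrite !in_fset_set// !inE => /XA As /XA Ar; exact: antiA.
Qed.

End Norms.

(** * The embedding of [S2] *)

Definition embedding {R : realType} (g : seq bool -> R -> R) (x : seq bool -> R) (t : R) : R :=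
  limn (fun N => partial g x N t).

Section Embedding.
Context {R : realType}.
Variables (a b c d : seq bool -> R) (g : seq bool -> R -> R).
Hypothesis hT : tree_family_of_trapezoids a b c d g.
Hypothesis hO : forall s, b (rcons s false) < a (rcons s true).
Implicit Types (t : R) (P : seq R) (x y : seq bool -> R).

Lemma partial_tail x k m n t : (forall s, `|x s| <= k) -> (m <= n)%N ->
  `|partial g x n t - partial g x m t| <= 2 * k * amplitude m.
Proof.
move=> xk mn; have k0 : 0 <= k by exact: le_trans (xk [::]).
rewrite /partial (@big_cat_nat _ _ _ m 0 n)//= addrAC subrr add0r.
apply: le_trans (ler_norm_sum _ _ _) _.
apply: (@le_trans _ _ (\sum_(m <= j < n) k * amplitude j)).
  by apply: ler_sum => j _; exact: level_bound.
rewrite -mulr_sumr [2 * k]mulrC -mulrA ler_wpM2l//; exact: amplitude_tail.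
Qed.

Lemma embedding_cvg x k t : (forall s, `|x s| <= k) ->
  partial g x n t @[n --> \oo] --> embedding g x t.
Proof.
move=> xk; have k0 : 0 <= k by exact: le_trans (xk [::]).
apply: normed_cvg; apply: nondecreasing_is_cvgn.
  by apply: nondecreasing_series => n _ _ /=.
exists (k * 2) => _ [n _ <-] /=.
apply: (@le_trans _ _ (\sum_(0 <= j < n) k * amplitude j)).
  by apply: ler_sum => j _; exact: level_bound.
rewrite -mulr_sumr ler_wpM2l//; have := amplitude_tail (R := R) 0 n.
by rewrite /= mulr1.
Qed.

Lemma embedding_tail x k m t : (forall s, `|x s| <= k) ->
  `|embedding g x t - partial g x m t| <= 2 * k * amplitude m.
Proof.
move=> xk; apply: (@cvgr_to_le _ \oo _ _
  (fun n => `|partial g x n t - partial g x m t|)).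
  by apply: cvg_norm; apply: cvgB; [exact: embedding_cvg xk|exact: cvg_cst].
by near=> n; apply: partial_tail => //; near: n; exact: nbhs_infty_ge.
Unshelve. all: by end_near. Qed.

Lemma embedding_linear k x y k1 k2 t : (forall s, `|x s| <= k1) -> (forall s, `|y s| <= k2) ->
  embedding g (fun s => k * x s + y s) t = k * embedding g x t + embedding g y t.
Proof.
move=> xk yk; apply: cvg_lim => //.
rewrite (_ : (fun N => _) = (fun N => k * partial g x N t + partial g y N t)).
  apply: cvgD; last exact: embedding_cvg yk.
  by apply: cvgM; [exact: cvg_cst|exact: embedding_cvg xk].
apply/funext => N; rewrite /partial mulr_sumr -big_split /=; apply: eq_bigr => n _.
rewrite /level (eq_bigr (fun u => k * (x (label u) * phi g u t) + y (label u) * phi g u t)).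
  by rewrite big_split -mulr_sumr /=; ring.
by move=> u _; ring.
Qed.

Lemma embedding_qv x k K P : (forall s, `|x s| <= k) ->
  (forall N, qv (partial g x N) P <= K) -> qv (embedding g x) P <= K.
Proof.
move=> xk PK; apply: (@cvgr_to_le _ \oo _ _ (fun N => qv (partial g x N) P)); last first.
  by near=> N; exact: PK.
apply: (cvg_big (op := +%R)) => [|i _]; first by move=> ?; exact: add_continuous.
by apply: cvgM; apply: cvgB; exact: embedding_cvg xk.
Unshelve. all: by end_near. Qed.

Lemma embedding_finite x N t : (forall s, (N <= size s)%N -> x s = 0) ->
  embedding g x t = partial g x N t.
Proof.
move=> x0; apply: cvg_lim => //; apply: cvg_near_cst; near=> n.
have Nn : (N <= n)%N by near: n; exact: nbhs_infty_ge.
rewrite /partial (@big_cat_nat _ _ _ N 0 n)//= [X in _ + X]big_nat_cond.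
rewrite [X in _ + X]big1 ?addr0// => m /andP[/andP[Nm _] _]; rewrite /level big_seq big1 ?mulr0// => u um.
by rewrite x0 ?mul0r// size_label (size_mem_bumps um).
Unshelve. all: by end_near. Qed.

Lemma partial_lipschitz x N : lipschitz1 (partial g x N).
Proof.
apply: lipschitz1_sum => n; apply: lipschitz1Z; apply: lipschitz1_sum => u.
by apply: lipschitz1Z; exact: phi_lipschitz.
Qed.

Lemma embedding_continuous x k : (forall s, `|x s| <= k) -> continuous (embedding g x).
Proof.
move=> xk z; have k0 : 0 <= k by exact: le_trans (xk [::]).
apply/cvgrPdist_le => e e0.
have k1 : 0 < 2 * k + 1 by lra.
have [m /(_ m (leqnn m)) hm] := amplitude_small (divr_gt0 (divr_gt0 e0 (ltr0Sn _ 2)) k1).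
have me : 2 * k * amplitude m <= e / 3.
  apply: (@le_trans _ _ ((2 * k + 1) * amplitude m)).
    by rewrite ler_wpM2r ?amplitude_ge0// lerDl.
  by rewrite mulrC -ler_pdivlMr.
have cz : {for z, continuous (partial g x m)} by exact: (lipschitz1_continuous (partial_lipschitz x m)).
have /cvgrPdist_le/(_ (e / 3) (divr_gt0 e0 (ltr0Sn _ 2))) := cz.
apply: filterS => t ht.
have := embedding_tail m z xk; have := embedding_tail m t xk.
rewrite !ler_norml => /andP[? ?] /andP[? ?].
by move: ht; rewrite !ler_norml => /andP[? ?]; apply/andP; split; lra.
Qed.

Lemma partial_out x N t : ~ `[0, 1]%classic t -> partial g x N t = 0.
Proof.
rewrite /= in_itv /= => nt; rewrite /partial big1// => n _; rewrite /level big1 ?mulr0// => u _.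
rewrite (phi_out hT) ?mulr0//; have [h1 _ _ _ h2] := tree_nodeP hT (node u).
by have [t0|t0] := ltP t 0; [left|right; have [//|t1] := ltP 1 t]; [lra|lra|case: nt; rewrite t0 t1].
Qed.

Lemma partial0 x N : partial g x N 0 = 0.
Proof.
rewrite /partial big1// => n _; rewrite /level big1 ?mulr0// => u _.
by rewrite (phi_out hT) ?mulr0//; have [h1 _ _ _ h2] := tree_nodeP hT (node u); left; lra.
Qed.

Lemma embedding_out x t : ~ `[0, 1]%classic t -> embedding g x t = 0.
Proof.
move=> nt; apply: cvg_lim => //; rewrite (_ : (fun N => _) = (fun=> 0)); first exact: cvg_cst.
by apply/funext => N; rewrite partial_out.
Qed.

Lemma embedding0 x : embedding g x 0 = 0.
Proof.
apply: cvg_lim => //; rewrite (_ : (fun N => _) = (fun=> 0)); first exact: cvg_cst.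
by apply/funext => N; rewrite partial0.
Qed.

Lemma partial_V20 x N : V20 (partial g x N).
Proof.
apply: lipschitz_V20; [exact: partial_out|exact: partial0|exact: partial_lipschitz].
Qed.

Lemma partial_span x N : linear_span g (partial g x N).
Proof.
pose J : seq (nat * (seq letter * nat)) :=
  [seq (n, w) | n <- iota 0 N, w <- [seq (u, i) | u <- bumps n, i <- iota 0 (chain_length n)]].
have := @linear_span_sum _ _ _ g J
  (fun j => amplitude j.1 * (x (label j.2.1) * (chain_length j.1)%:R^-1))
  (fun j => chain j.2.1 j.2.2).
congr (linear_span g _); apply/funext => t.
rewrite /J big_allpairs_dep /partial /index_iota subn0; apply: eq_bigr => n _.
rewrite big_allpairs_dep /level mulr_sumr big_seq [RHS]big_seq; apply: eq_bigr => u un /=.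
rewrite /phi (size_mem_bumps un).
rewrite -[X in _ = _ * (_ * (_ * X))](big_mkord xpredT (fun i => g (chain u i) t)) /index_iota subn0.
by rewrite !mulr_sumr; apply: eq_bigr => i _; rewrite !mulrA.
Qed.

Lemma partial_closed_span x N : closed_span g (partial g x N).
Proof.
split; first exact: partial_V20.
move=> e e0; exists (partial g x N); first exact: partial_span.
apply: (@le_lt_trans _ _ 0%:E); last by rewrite lte_fin.
apply: V2_norm_le => // P _; rewrite (@qv_eq _ _ (fun=> 0)); last by move=> t _; rewrite subrr.
by rewrite /qv big1 ?sqr_ge0// => i _; rewrite subrr expr0n.
Qed.

Lemma S2_sup x k : (S2_norm x <= k%:E)%E -> forall s, `|x s| <= k.
Proof.
move=> xk s; have k0 : 0 <= k.
  rewrite -lee_fin; apply: le_trans xk; apply: ereal_sup_ge.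
  by exists (sqrte (\esum_(s in set0) (x s ^+ 2)%:E)); [exists set0|rewrite sqrte_ge0].
rewrite -ler_sqr ?nnegrE// real_normK ?num_real//.
have := S2_norm_seq (l := [:: s]) xk; rewrite big_seq1; apply => // r r'.
by rewrite !inE => /eqP -> /eqP ->.
Qed.

Lemma embedding_qv_le x k P : (S2_norm x <= k%:E)%E -> sorted <%R P ->
  qv (embedding g x) P <= (4 * k) ^+ 2.
Proof.
move=> xk sP; have xs := S2_sup xk; have k0 : 0 <= k by exact: le_trans (xs [::]).
apply: embedding_qv xs _ => N; apply: (upper_estimate hT hO) => // l ul al.
exact: S2_norm_seq.
Qed.

Lemma embedding_V2_le x k : (S2_norm x <= k%:E)%E -> (V2_norm (embedding g x) <= (4 * k)%:E)%E.
Proof.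
move=> xk; have k0 : 0 <= k by exact: le_trans (S2_sup xk [::]).
by apply: V2_norm_le; [rewrite mulr_ge0|move=> P [_ sP _]; exact: embedding_qv_le].
Qed.

Lemma embedding_foot_top x k u : (forall s, `|x s| <= k) -> u \in bumps (size u) ->
  embedding g x (top c u) - embedding g x (a (node u)) =
  amplitude (size u) * x (label u).
Proof.
move=> xk uu.
have h : partial g x n (top c u) - partial g x n (a (node u)) @[n --> \oo] -->
    embedding g x (top c u) - embedding g x (a (node u)).
  by apply: cvgB; exact: embedding_cvg xk.
have h' : partial g x n (top c u) - partial g x n (a (node u)) @[n --> \oo] -->
    amplitude (size u) * x (label u).
  apply: cvg_near_cst; near=> n.
  have un : (size u < n)%N by near: n; exact: nbhs_infty_gt.
  have lev m : level g x m (top c u) - level g x m (a (node u)) =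
      if m == size u then amplitude (size u) * x (label u) else 0.
    rewrite /level -mulrBr -sumrB (eq_bigr (fun v => x (label v) * (v == u)%:R)); last first.
      by move=> v _; rewrite -mulrBr (phi_foot_top hT hO).
    case: eqVneq => [->|mu].
      rewrite (bigD1_seq u) ?uniq_bumps//= eqxx mulr1 big1 ?addr0// => v /negbTE ->.
      by rewrite mulr0.
    rewrite big_seq big1 ?mulr0// => v vm; case: eqVneq => [vu|_]; last by rewrite mulr0.
    by move: mu; rewrite -(size_mem_bumps vm) vu eqxx.
  rewrite /partial -sumrB (eq_bigr _ (fun m _ => lev m)) -big_mkcond /=.
  by rewrite big_nat1_eq un.
exact: (cvg_unique _ h h').
Unshelve. all: by end_near. Qed.

(** For labels of different lengths the shorter bump is compared with the ancestor
of the other one at its level, which is another bump as the labels differ. *)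
Lemma foot_top_disjoint u v : u != v ->
  (prefix (label u) (label v) -> label u = label v) ->
  (prefix (label v) (label u) -> label v = label u) ->
  top c u < a (node v) \/ top c v < a (node u).
Proof.
wlog uv : u v / (size u <= size v)%N.
  move=> H nuv h1 h2; have [/H|/ltnW/H] := leqP (size u) (size v); first exact.
  by rewrite eq_sym => /(_ nuv h2 h1) []; [right|left].
move=> nuv h _.
have /andP[u1 u2] := top_in hT u; have /andP[v1 v2] := top_in hT v.
have [l1 l2 l3 l4] := tree_lt hT (node u); have [m1 m2 m3 m4] := tree_lt hT (node v).
have := node_desc hT (take (size u) v) (drop (size u) v).
rewrite cat_take_drop => -[h1 h2].
have su : size u = size (take (size u) v) by rewrite size_takel.
have nt : u != take (size u) v.
  apply: contra nuv => /eqP E.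
  have lE : label u = label v by apply: h; rewrite prefixE size_label -label_take -E.
  have sE : size u = size v by rewrite -size_label lE size_label.
  by rewrite E sE take_size.
by have [?|?] := node_disjoint hT hO su nt; [left|right]; lra.
Qed.

Lemma embedding_reaches (L : seq (seq letter)) x k delta z z' :
  (forall s, `|x s| <= k) -> 0 < delta -> z <= z' -> uniq L ->
  antichain_seq (map label L) -> {in L, forall u, u \in bumps (size u)} ->
  {in L, forall u, [/\ z <= a (node u), top c u <= z' & top c u - a (node u) < delta]} ->
  reaches (embedding g x) delta z z' (\sum_(u <- L) amplitude (size u) ^+ 2 * x (label u) ^+ 2).
Proof.
move=> xk d0 zz' uL aL bL hL.
rewrite (eq_big_seq (fun u => (embedding g x (top c u) - embedding g x (a (node u))) ^+ 2)); last first.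
  by move=> u uin /=; rewrite (embedding_foot_top xk) ?bL// exprMn.
apply: (reaches_disjoint (p := fun u => a (node u)) (q := fun u => top c u)) => //.
  move=> u uin; have [h1 h2 h3] := hL u uin; split => //.
  by have /andP[? ?] := top_in hT u; have [? _ _ _] := tree_lt hT (node u); lra.
by move=> u v uin vin uv; apply: foot_top_disjoint => // h; apply: aL h; exact: map_f.
Qed.

(** The bumps whose labels run over an antichain are crossed from foot to top; those
with a common label have total mass 1. *)
Lemma embedding_V2_ge x k K : (forall s, `|x s| <= k) ->
  (V2_norm (embedding g x) <= K%:E)%E -> (S2_norm x <= K%:E)%E.
Proof.
move=> xk fK.
have K0 : 0 <= K by rewrite -lee_fin (le_trans (V2_norm_ge0 (embedding g x))).
apply: S2_norm_le => // l ul al.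
pose L := [seq u | s <- l, u <- [seq u <- bumps (size s) | label u == s]].
have LP u : reflect (u \in bumps (size u) /\ label u \in l) (u \in L).
  apply: (iffP allpairsPdep) => [[s [v [sl]]]|[ub ul']].
    rewrite mem_filter => /andP[/eqP vs vb] ->.
    by rewrite vs sl -[size v]size_label vs vb.
  by exists (label u), u; split => //; rewrite mem_filter eqxx size_label.
have : reaches (embedding g x) 2 0 1
    (\sum_(u <- L) amplitude (size u) ^+ 2 * x (label u) ^+ 2).
  apply: (embedding_reaches xk); rewrite ?ltr0n ?ler01//.
  - apply: allpairs_uniq_dep => //; first by move=> s _; rewrite filter_uniq// uniq_bumps.
    move=> [s u] [r v] /allpairsPdep[s' [u' [_ + [-> ->]]]] /allpairsPdep[r' [v' [_ + [-> ->]]]] /= E.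
    by rewrite !mem_filter E => /andP[/eqP -> _] /andP[/eqP -> _].
  - by move=> _ _ /mapP[u /LP[_ hu] ->] /mapP[v /LP[_ hv] ->]; exact: al.
  - by move=> u /LP[].
  - move=> u _; have [h1 h2 h3 h4 h5] := tree_nodeP hT (node u).
    by have /andP[? ?] := top_in hT u; split; lra.
move=> /(reaches_partition ltr01 (I := `[0, 1]%classic)).
move=> [|P [PI _ LeP]]; first by move=> t; rewrite /= in_itv.
apply: le_trans (V2_norm_qv fK PI); apply: le_trans LeP.
rewrite big_allpairs_dep /=; apply: ler_sum => s _; rewrite big_filter.
rewrite (eq_bigr (fun u => x s ^+ 2 * amplitude (size s) ^+ 2)); last first.
  by move=> u /eqP us; rewrite us -[size u]size_label us mulrC.
by rewrite -mulr_sumr sum_amplitude mulr1.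
Qed.

Lemma S2_bounded x : S2 x -> exists k, forall s, `|x s| <= k.
Proof.
move=> /(_ 1 ltr01)[y /finite_seqP[l yl] xy].
have hxy := S2_sup (ltW xy); exists (1 + \sum_(s <- l) `|y s|) => s.
have -> : x s = (x s - y s) + y s by rewrite subrK.
apply: le_trans (ler_normD _ _) _; apply: lerD => //.
have [ys|ys] := eqVneq (y s) 0; first by rewrite ys normr0 sumr_ge0.
have sl : s \in l by have : [set s | y s != 0] s by []; rewrite yl.
by rewrite (big_rem s sl)/= lerDl sumr_ge0.
Qed.

Theorem S2_embedding : S2_isomorphic_to_subspace_of (closed_span g).
Proof.
have diff x y : (exists k, forall s, `|x s| <= k) -> (exists k, forall s, `|y s| <= k) ->
    forall t, embedding g x t - embedding g y t = embedding g (fun s => x s - y s) t.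
  move=> [k xk] [l yl] t; have := embedding_linear (-1) t yl xk.
  by rewrite mulN1r addrC => <-; congr (embedding g _ t); apply/funext => s; ring.
have upper x : S2 x -> (V2_norm (embedding g x) <= 4%:E * S2_norm x)%E.
  move=> _; have : (0 <= S2_norm x)%E.
    by apply: ereal_sup_ge; exists (sqrte (\esum_(s in set0) (x s ^+ 2)%:E)); [exists set0|rewrite sqrte_ge0].
  case E : (S2_norm x) => [k| |]// _; last by rewrite gt0_muley// ?leey// lte_fin.
  by rewrite -EFinM; apply: embedding_V2_le; rewrite E.
exists (embedding g); split.
- move=> x Sx; have [k xk] := S2_bounded Sx.
  have approx e : 0 < e -> exists y N, [/\ embedding g y = partial g y N &
      (V2_norm (fun t => embedding g x t - embedding g y t)%R < e%:E)%E].
    move=> e0; have [y fy xy] := Sx (e / 8) (divr_gt0 e0 (ltr0Sn _ 7)).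
    have Sy : exists k, forall s, `|y s| <= k.
      exists (e / 8 + k) => s; have := S2_sup (ltW xy) s; have := xk s.
      by rewrite !ler_norml => /andP[? ?] /andP[? ?]; apply/andP; split; lra.
    move: (fy) => /finite_seqP[l yl].
    exists y, (\max_(s <- l) size s).+1; split.
      apply/funext => t; apply: embedding_finite => s; apply: contraTeq => ys.
      have sl : s \in l by have : [set s | y s != 0] s by []; rewrite yl.
      by rewrite -ltnNge ltnS; apply: leq_bigmax_seq.
    rewrite (_ : (fun t => _) = embedding g (fun s => x s - y s)); last first.
      by apply/funext => t; apply: diff => //; exists k.
    apply: le_lt_trans (embedding_V2_le (ltW xy)) _; rewrite lte_fin.
    by lra.
  have V2x : V2 (embedding g x).
    split; [by move=> t; exact: embedding_out|exact: embedding0|].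
    have [y [N [yN /ltW xy]]] := approx 1 ltr01.
    have [[_ _ yfin] _] := partial_V20 y N; rewrite -yN in yfin.
    have : V2_norm (embedding g y) \is a fin_num.
      by rewrite fin_numElt yfin andbT (lt_le_trans _ (V2_norm_ge0 _))// ltNyr.
    move=> /fineK => yE; set K := fine _ in yE.
    have K0 : 0 <= K by rewrite fine_ge0// V2_norm_ge0.
    apply: (@le_lt_trans _ _ (2 * K + 2)%:E); last exact: ltry.
    apply: V2_norm_le => [|P PI]; first by lra.
    have h1 := V2_norm_qv xy PI.
    have h2 : qv (embedding g y) P <= K ^+ 2 by apply: V2_norm_qv PI; rewrite yE.
    have := qvD_le (fun t => embedding g x t - embedding g y t) (embedding g y) P.
    rewrite (@qv_eq _ (fun t => _ - _ + _) (embedding g x)); last by move=> t _ /=; rewrite subrK.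
    by have := sqr_ge0 K; nra.
  split.
    apply/V20P; split => //; apply: small_scale_closed => e e0.
    have [y [N [yN /ltW xy]]] := approx e e0; exists (embedding g y) => //.
    by rewrite yN; have /V20P[] := partial_V20 y N.
  move=> e e0; have [y [N [yN xy]]] := approx e e0; exists (embedding g y) => //.
  by rewrite yN; exact: partial_span.
- move=> k x y /S2_bounded[kx xk] /S2_bounded[ky yk] t.
  exact: embedding_linear xk yk.
- exists 1, 4; split => // x Sx; rewrite upper// andbT mul1e.
  have [k xk] := S2_bounded Sx.
  have := V2_norm_ge0 (embedding g x).
  case E : (V2_norm (embedding g x)) => [K| |]// _; last by rewrite leey.
  by apply: embedding_V2_ge xk _; rewrite E.
Qed.

End Embedding.

(** * The measure of a function of [V2] *)

Section MuTilde.
Context {R : realType}.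
Implicit Types (f h : R -> R) (P : seq R) (I J : set R).
Local Open Scope ereal_scope.

Definition small_mesh_sup f I (delta : R) : \bar R :=
  ereal_sup [set (v2 f P ^+ 2)%:E | P in [set P | partition_in I P /\ (mesh P < delta)%R]].

Lemma mu_tilde_le f I (delta : R) : (0 < delta)%R ->
  mu_tilde f I <= small_mesh_sup f I delta.
Proof. by move=> d0; apply: ereal_inf_lbound; exists delta. Qed.

Lemma mu_tilde_ge f I z : (forall delta : R, (0 < delta)%R -> z <= small_mesh_sup f I delta) ->
  z <= mu_tilde f I.
Proof. by move=> h; apply: le_ereal_inf_tmp => _ [delta /= d0 <-]; exact: h. Qed.

Lemma small_mesh_sup_ge f I delta P : partition_in I P -> (mesh P < delta)%R ->
  (qv f P)%:E <= small_mesh_sup f I delta.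
Proof. by move=> PI Pd; rewrite -sqr_v2; apply: ereal_sup_ubound; exists P. Qed.

Lemma small_mesh_sup_le f I delta z :
  (forall P, partition_in I P -> (mesh P < delta)%R -> (qv f P)%:E <= z) ->
  small_mesh_sup f I delta <= z.
Proof. by move=> h; apply: ge_ereal_sup => _ [P [PI Pd] <-]; rewrite sqr_v2 h. Qed.

Lemma mu_tilde_mono f I J : I `<=` J -> mu_tilde f I <= mu_tilde f J.
Proof.
move=> IJ; apply: mu_tilde_ge => delta d0; apply: le_trans (mu_tilde_le f I d0) _.
apply: small_mesh_sup_le => P [P1 P2 PI]; apply: small_mesh_sup_ge.
by split => // t /PI /IJ.
Qed.

Lemma small_mesh_sup_ge0 f (y delta : R) : (0 < y)%R -> (0 < delta)%R ->
  0 <= small_mesh_sup f `[0%R, y] delta.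
Proof.
move=> y0 d0; have [P [PI Pd eP]] := reaches_partition (I := `[0%R, y]%classic) y0
  (fun t ty => ty) (reaches_0 f d0 (ltW y0)).
by apply: le_trans (small_mesh_sup_ge f PI Pd); rewrite lee_fin.
Qed.

Lemma mu_tilde_ge0 f (y : R) : (0 < y)%R -> 0 <= mu_tilde f `[0%R, y].
Proof. by move=> y0; apply: mu_tilde_ge => delta d0; exact: small_mesh_sup_ge0. Qed.

Lemma mu_tilde_bounded f (y K : R) : (y <= 1)%R -> V2_norm f <= K%:E ->
  mu_tilde f `[0%R, y] <= (K ^+ 2)%:E.
Proof.
move=> y1 fK; apply: le_trans (mu_tilde_le f _ (ltr01)) _.
apply: small_mesh_sup_le => P [P1 P2 PI] _; rewrite lee_fin; apply: V2_norm_qv => //.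
split => // t /PI; rewrite /= !in_itv /= => /andP[-> ty] /=; exact: le_trans ty y1.
Qed.

(** A partition of the first interval may stop before [z]; an energy-free path
with short steps fills the gap. *)
Lemma mu_tilde_superadditive f (z y L : R) : (0 < z)%R -> (z < y)%R ->
  (forall delta : R, (0 < delta)%R -> reaches f delta z y L) ->
  mu_tilde f `[0%R, z] + L%:E <= mu_tilde f `[0%R, y].
Proof.
move=> z0 zy hL; apply: mu_tilde_ge => delta d0; rewrite -leeBrDr//.
apply: le_trans (mu_tilde_le f _ d0) _; apply: small_mesh_sup_le => P PI Pd.
rewrite leeBrDr// -EFinD.
have [x0 [x1 [x0z x1z x01 hP]]] := partition_reaches f PI.
move: x0z x1z; rewrite /= !in_itv /= => /andP[x00 x0z] /andP[x10 x1z].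
have hR := reaches_trans (reaches_trans (hP _ Pd) (reaches_0 f d0 x1z)) (hL _ d0).
rewrite addr0 in hR; have x0y : (x0 < y)%R by lra.
have [|Q [QI Qd eQ]] := reaches_partition (I := `[0%R, y]%classic) x0y _ hR.
  by move=> t /andP[t1 t2]; rewrite /= in_itv /=; apply/andP; split; lra.
by apply: le_trans (small_mesh_sup_ge f QI Qd); rewrite lee_fin.
Qed.

Lemma sorted_split (z : R) P : sorted <%R P -> exists P1 P2,
  [/\ P = P1 ++ P2, {in P1, forall t, t <= z}%R & {in P2, forall t, z < t}%R].
Proof.
elim: P => [|t P IH] sP; first by exists [::], [::].
have [P1 [P2 [E h1 h2]]] := IH (path_sorted sP).
have [tz|zt] := leP t z.
  exists (t :: P1), P2; split => //; first by rewrite E.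
  by move=> u; rewrite inE => /predU1P[->|/h1].
exists [::], (t :: P); split => // u; rewrite inE => /predU1P[->//|uP].
have /allP/(_ _ uP) : all (<%R t) P by exact: order_path_min lt_trans sP.
by move=> /= tu; exact: lt_trans zt tu.
Qed.

(** A stretch on which the function is square absolutely continuous adds nothing;
the increment that crosses its end point is small by continuity. *)
Lemma mu_tilde_stationary f h (z y : R) : (0 < z)%R -> (z <= y)%R -> (y <= 1)%R ->
  {for z, continuous f} -> small_scale h -> (forall t, z <= t <= y -> f t = h t)%R ->
  mu_tilde f `[0%R, y] <= mu_tilde f `[0%R, z].
Proof.
move=> z0 zy y1 cf hs fh; apply: mu_tilde_ge => d1 d10.
apply/lee_addgt0Pr => e e0.
pose r := Num.sqrt (e / 2); have r0 : (0 < r)%R by rewrite sqrtr_gt0 divr_gt0.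
have r2 : (r ^+ 2 = e / 2)%R by rewrite sqr_sqrtr// divr_ge0// ltW.
have /cvgrPdist_lt/(_ (r / 2)%R (divr_gt0 r0 (ltr0Sn _ 1)))/nbhs_ballP[d2 /= d20 fz] := cf.
have [d3 d30 hd] := hs (e / 2)%R (divr_gt0 e0 (ltr0Sn _ 1)).
pose delta := Num.min d1 (Num.min d2 d3).
have [dd1 dd2 dd3] : [/\ delta <= d1, delta <= d2 & delta <= d3]%R.
  by rewrite /delta !ge_min !lexx !orbT.
have d0 : (0 < delta)%R by rewrite !lt_min d10 d20 d30.
apply: le_trans (mu_tilde_le f _ d0) _; apply: small_mesh_sup_le => P [sP Ps PI] Pd.
set S := small_mesh_sup _ _ _; have S0 : 0 <= S by exact: small_mesh_sup_ge0.
have hleft t l : path <%R t l -> {in t :: l, forall u, 0 <= u <= z}%R ->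
    (mesh (t :: l) < delta)%R -> (qv f (t :: l))%:E <= S.
  case: l => [|t' l] pl hl ml; first by rewrite qv1.
  apply: small_mesh_sup_ge; last exact: lt_le_trans ml dd1.
  by split => // u /hl; rewrite /= in_itv.
have hright t l : path <%R t l -> {in t :: l, forall u, z <= u <= y}%R ->
    (mesh (t :: l) < delta)%R -> (qv f (t :: l) <= e / 2)%R.
  case: l => [|t' l] pl hl ml; first by rewrite qv1 divr_ge0// ltW.
  rewrite (@qv_eq _ f h); last by move=> u /hl /fh.
  apply: hd; last exact: lt_le_trans ml dd3.
  by split => // u /hl /andP[? ?]; rewrite /= in_itv /=; apply/andP; split; lra.
have {}PI t : t \in P -> (0 <= t <= y)%R by move=> /PI; rewrite /= in_itv.
have [P1 [P2 [E h1 h2]]] := sorted_split z Ps.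
case: P1 P2 E h1 h2 => [|t1 l1] [|t2 l2] /= E h1 h2.
- by rewrite E in sP.
- rewrite E in Ps Pd PI *; apply: (@le_trans _ _ (e / 2)%:E).
    rewrite lee_fin; apply: hright => // u uP; have := h2 u uP; have /andP[? ?] := PI u uP.
    by move=> ?; apply/andP; split; lra.
  by rewrite -[X in X <= _]add0e leeD// lee_fin; lra.
- rewrite cats0 in E; rewrite E in Ps Pd PI *; apply: (@le_trans _ _ S).
    apply: hleft => // u uP; have := h1 u uP; have /andP[? ?] := PI u uP.
    by move=> ?; apply/andP; split; lra.
  by rewrite leeDl// lee_fin ltW.
- move: Ps Pd; rewrite E -cat_cons /= cat_path mesh_cat mesh_cons2 !gt_max /=.
  move=> /andP[p1 /andP[_ p2]] /andP[m1 /andP[m12 m2]].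
  rewrite qv_cat qv_cons2.
  have q1 : (qv f (t1 :: l1))%:E <= S.
    apply: hleft => // u uP; have := h1 u uP.
    have /andP[? ?] : (0 <= u <= y)%R by apply: PI; rewrite E -cat_cons mem_cat uP.
    by move=> ?; apply/andP; split; lra.
  have q2 : (qv f (t2 :: l2) <= e / 2)%R.
    apply: hright => // u uP; have := h2 u uP.
    have /andP[? ?] : (0 <= u <= y)%R by apply: PI; rewrite E -cat_cons mem_cat uP orbT.
    by move=> ?; apply/andP; split; lra.
  have lz : (last t1 l1 <= z)%R by apply: h1; exact: mem_last.
  have zt : (z < t2)%R by apply: h2; exact: mem_head.
  have j1 : (`|f z - f (last t1 l1)| < r / 2)%R.
    by apply: fz; rewrite /ball /= ger0_norm; lra.
  have j2 : (`|f z - f t2| < r / 2)%R.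
    by apply: fz; rewrite /ball /= ltr0_norm; lra.
  have q3 : ((f t2 - f (last t1 l1)) ^+ 2 <= e / 2)%R.
    move: j1 j2; rewrite -r2 !ltr_norml => /andP[? ?] /andP[? ?].
    by rewrite -real_normK ?num_real// ler_sqr ?nnegrE ?(ltW r0)// ler_norml; apply/andP; split; lra.
  rewrite EFinD leeD// lee_fin; lra.
Qed.

End MuTilde.


Section MuExists.
Context {R : realType}.

Section ClippedMeasure.
Variable G : cumulative R R.
Local Open Scope ereal_scope.
Local Notation lsm := (lebesgue_stieltjes_measure G).

Definition clip (t : R) : R := Num.max 0%R t.

Let clip_measurable : measurable_fun setT (clip : measurableTypeR R -> measurableTypeR R).
Proof. by apply: measurable_realfun.measurable_maxr; [exact: measurable_cst|exact: measurable_id]. Qed.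

(** Taking the image under [clip] puts no mass outside the unit interval, whatever
[G] is, and the initial segments of the unit interval are pulled back to half-open
intervals, the measure of which is an increment of [G]. *)
Definition clipped_measure (B : set (measurableTypeR R)) : \bar R :=
  lsm (clip @^-1` B `&` `](-1)%R, 1%R]).

Let unit_measurable : measurable (`](-1)%R, 1%R] : set (measurableTypeR R)).
Proof. exact: measurable_itv. Qed.

Let clip_preimage (B : set (measurableTypeR R)) : measurable B -> measurable (clip @^-1` B : set (measurableTypeR R)).
Proof. by move=> mB; rewrite -[X in measurable X]setTI; exact: clip_measurable. Qed.

Lemma stieltjes_ocitv (x y : R) : (x <= y)%R -> lsm `]x, y] = (G y - G x)%:E.
Proof.
move=> xy; rewrite /lebesgue_stieltjes_measure /measure_extension measurable_mu_extE/=.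
  by rewrite wlength_itv_bnd.
exact: is_ocitv.
Qed.

Lemma clipped_measure_ge0 B : measurable B -> 0 <= clipped_measure B.
Proof. by move=> mB; exact: measure_ge0. Qed.

Let clipped_measure0 : clipped_measure set0 = 0.
Proof. by rewrite /clipped_measure preimage_set0 set0I measure0. Qed.

Let clipped_measure_fin B : measurable B -> clipped_measure B \is a fin_num.
Proof.
move=> mB; rewrite ge0_fin_numE ?clipped_measure_ge0//.
apply: (@le_lt_trans _ _ (lsm `](-1)%R, 1%R])).
  by apply: le_measure; rewrite ?inE//; apply: measurableI => //; exact: clip_preimage.
by rewrite stieltjes_ocitv ?ltry//; lra.
Qed.

Let clipped_measure_additive : semi_sigma_additive clipped_measure.
Proof.
move=> F mF tF mUF.
have := @measure_semi_sigma_additive _ _ _ (mrestr lsm unit_measurable)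
  (fun n => clip @^-1` (F n)).
rewrite /mrestr -preimage_bigcup; apply.
- by move=> n; exact: clip_preimage.
- by move=> i j _ _ [t [h1 h2]]; apply: tF => //; exists (clip t).
- exact: clip_preimage.
Qed.

HB.instance Definition _ := isCharge.Build _ (measurableTypeR R) R clipped_measure
  clipped_measure0 clipped_measure_fin clipped_measure_additive.

Definition clipped_charge : borel_charge (R := R) := clipped_measure.

End ClippedMeasure.

Section Distribution.
Variables (f : R -> R) (K : R).
Hypothesis fK : (V2_norm f <= K%:E)%E.

Definition mu_mass (y : R) : R := fine (mu_tilde f `[0, y]).

Lemma mu_massE y : 0 < y <= 1 -> mu_tilde f `[0, y] = (mu_mass y)%:E.
Proof.
move=> /andP[y0 y1]; rewrite /mu_mass fineK// fin_numElt.
rewrite (lt_le_trans (ltNyr 0))//=; last exact: mu_tilde_ge0.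
by apply: le_lt_trans (mu_tilde_bounded y1 fK) _; exact: ltry.
Qed.

Lemma mu_mass_ge0 y : 0 < y <= 1 -> 0 <= mu_mass y.
Proof. by move=> hy; rewrite -lee_fin -mu_massE// mu_tilde_ge0//; case/andP: hy. Qed.

Lemma mu_mass_mono y z : 0 < y -> y <= z -> z <= 1 -> mu_mass y <= mu_mass z.
Proof.
move=> y0 yz z1; rewrite -lee_fin -!mu_massE ?(le_trans yz z1) ?(lt_le_trans y0 yz) ?y0//.
apply: mu_tilde_mono => t; rewrite /= !in_itv /= => /andP[-> ty] /=; exact: le_trans ty yz.
Qed.

(** The right limit of [mu_mass] is an infimum by monotonicity; at 1, where the
unit interval ends, the value itself is taken. *)
Definition distribution (x : R) : R :=
  if x < 0 then 0 else if x < 1 then inf [set mu_mass y | y in `]x, 1]%classic] else mu_mass 1.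

Let masses x : set R := [set mu_mass y | y in `]x, 1]%classic].

Let masses_lb x : 0 <= x -> lbound (masses x) 0.
Proof.
move=> x0 _ [y /= + <-]; rewrite in_itv /= => /andP[xy y1].
by apply: mu_mass_ge0; rewrite (le_lt_trans x0 xy).
Qed.

Let distribution_lt1 x : 0 <= x < 1 -> distribution x = inf (masses x).
Proof. by move=> /andP[x0 x1]; rewrite /distribution ltNge x0 /= x1. Qed.

Let distribution_ge1 x : 1 <= x -> distribution x = mu_mass 1.
Proof. by move=> x1; rewrite /distribution !ltNge x1 (le_trans ler01 x1). Qed.

Let distribution_le x y : 0 <= x -> x < y -> y <= 1 -> distribution x <= mu_mass y.
Proof.
move=> x0 xy y1; rewrite distribution_lt1 ?x0 ?(lt_le_trans xy y1)//.
apply: ge_inf; first by exists 0; exact: masses_lb.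
by exists y => //=; rewrite in_itv /= xy.
Qed.

Let distribution_ge z x : 0 <= x < 1 -> (forall y, x < y <= 1 -> z <= mu_mass y) ->
  z <= distribution x.
Proof.
move=> hx hz; rewrite distribution_lt1//; apply: lb_le_inf.
  by exists (mu_mass 1), 1 => //=; rewrite in_itv /= lexx andbT; case/andP: hx.
by move=> _ [y /= + <-]; rewrite in_itv /=; exact: hz.
Qed.

Let distribution_nondecreasing : nondecreasing distribution.
Proof.
move=> x x' xx'.
have [x0|x0] := ltP x 0.
  rewrite {1}/distribution x0; have [x'0|x'0] := ltP x' 0.
    by rewrite /distribution x'0.
  have [x'1|x'1] := ltP x' 1; last by rewrite distribution_ge1// mu_mass_ge0// ltr01 lexx.
  apply: distribution_ge => [|y /andP[xy y1]]; first by rewrite x'0.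
  by apply: mu_mass_ge0; rewrite y1 andbT (le_lt_trans x'0).
have x'0 : 0 <= x' by exact: le_trans xx'.
have [x'1|x'1] := ltP x' 1.
  apply: distribution_ge => [|y /andP[xy y1]]; first by rewrite x'0.
  by apply: distribution_le => //; exact: le_lt_trans xy.
rewrite [leRHS]distribution_ge1//; have [x1|x1] := ltP x 1; last by rewrite distribution_ge1.
exact: distribution_le.
Qed.

Let mu_mass_right x : 0 <= x < 1 -> mu_mass y @[y --> x^'+] --> distribution x.
Proof.
move=> /andP[x0 x1]; rewrite distribution_lt1 ?x0//.
apply: (@nondecreasing_at_right_cvgr _ mu_mass x (BRight 1)).
- by rewrite bnd_simp.
- move=> y z; rewrite !in_itv /= => /andP[xy y1] /andP[xz z1] yz.
  by apply: mu_mass_mono => //; exact: le_lt_trans xy.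
- by exists 0; exact: masses_lb.
Qed.

Let distribution_right_continuous : right_continuous distribution.
Proof.
move=> x; apply/cvgrPdist_le => e e0.
have [x0|x0] := ltP x 0.
  near=> t; have t0 : t < 0 by near: t; exact: nbhs_right_lt.
  by rewrite /distribution x0 t0 subrr normr0 ltW.
have [x1|x1] := ltP x 1; last first.
  near=> t; have xt : x < t by near: t; exact: nbhs_right_gt.
  by rewrite !distribution_ge1 ?subrr ?normr0 ?(ltW e0)// (le_trans x1 (ltW xt)).
have [y [xy y1 ye]] : exists y, [/\ x < y, y <= 1 & mu_mass y < distribution x + e].
  apply: contrapT => no; have : distribution x + e <= distribution x; last by lra.
  apply: distribution_ge => [|y /andP[xy y1]]; first by rewrite x0.
  by rewrite leNgt; apply/negP => ye; apply: no; exists y.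
near=> t; have xt : x < t by near: t; exact: nbhs_right_gt.
have ty : t < y by near: t; exact: nbhs_right_lt.
have h1 := distribution_nondecreasing (ltW xt).
have h2 : distribution t <= mu_mass y by apply: distribution_le => //; exact: le_trans (ltW xt).
by rewrite ler_norml; apply/andP; split; lra.
Unshelve. all: by end_near. Qed.

HB.instance Definition _ := isCumulative.Build R _ R distribution
  distribution_nondecreasing distribution_right_continuous.

Let clip_initial x : 0 <= x <= 1 ->
  clip @^-1` `[0, x]%classic `&` `](-1), 1]%classic = `](-1), x]%classic.
Proof.
move=> /andP[x0 x1]; apply/seteqP; split => t /=; rewrite !in_itv /= /clip.
  by move=> [/andP[_ h] /andP[-> _]] /=; apply: le_trans h; rewrite le_max lexx orbT.
move=> /andP[t1 tx]; split; last by rewrite t1 (le_trans tx x1).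
by rewrite le_max lexx /= ge_max x0 tx.
Qed.

Lemma is_mu_exists : exists nu : borel_charge, is_mu f nu.
Proof.
pose G : cumulative R R := distribution.
have initial x : 0 <= x <= 1 -> clipped_measure G `[0, x]%classic = (distribution x)%:E.
  move=> hx; rewrite /clipped_measure clip_initial// stieltjes_ocitv; last first.
    by case/andP: hx; lra.
  have -> : G (-1) = 0 by rewrite /G /= /distribution ltrN10.
  by rewrite subr0.
exists (clipped_charge G); split.
- move=> B mB B01; rewrite /clipped_charge /= /clipped_measure.
  rewrite (_ : _ `&` _ = set0) ?measure0//; apply/seteqP; split => // t /=.
  move=> [Bt]; rewrite in_itv /= => /andP[_ t1].
  have : (B `&` `[0, 1]) (clip t); last by rewrite B01.
  by split => //=; rewrite in_itv /= /clip le_max lexx /= ge_max ler01 t1.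
- by move=> B mB; exact: clipped_measure_ge0.
- move=> x /andP[x0 x1]; rewrite [X in _ --> X]initial ?x0 ?ltW//.
  apply: (@cvg_trans _ ((mu_mass y)%:E @[y --> x^'+])); last first.
    by apply: cvg_EFin; [near=> y|exact: mu_mass_right (introT andP (conj x0 x1))].
  apply: near_eq_cvg; near=> y; rewrite mu_massE//.
  have xy : x < y by near: y; exact: nbhs_right_gt.
  have y1 : y < 1 by near: y; exact: nbhs_right_lt.
  by rewrite (le_lt_trans x0 xy) ltW.
- rewrite [LHS]initial ?ler01 ?lexx// mu_massE ?ltr01 ?lexx//.
  by rewrite distribution_ge1.
Unshelve. all: by end_near. Qed.

End Distribution.
End MuExists.

(** * Separated measures along the branches *)

Section Charges.
Context {R : realType}.

Lemma ocitv_disjoint (x y x' y' : R) : y < x' \/ y' < x ->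
  `]x, y] `&` `]x', y'] = set0 :> set R.
Proof.
move=> h; apply/seteqP; split => // t []; rewrite /= !in_itv /= => /andP[h1 h2] /andP[h3 h4].
by case: h => ?; lra.
Qed.

Local Open Scope ereal_scope.

Lemma charge_disjoint_sum (nu : borel_charge (R := R)) (T : eqType) (s : seq T)
    (F : T -> set (measurableTypeR R)) :
  (forall i, measurable (F i)) -> uniq s ->
  {in s &, forall i j, i != j -> F i `&` F j = set0} ->
  nu (\big[setU/set0]_(i <- s) F i) = \sum_(i <- s) nu (F i).
Proof.
move=> mF; elim: s => [|i s IH] /=; first by rewrite !big_nil charge0.
move=> /andP[is_ us] dF; rewrite !big_cons chargeU//; last 2 first.
- exact: bigsetU_measurable.
- rewrite big_distrr /= big1_seq// => j /andP[_ js]; apply: dF.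
  + exact: mem_head.
  + by rewrite inE js orbT.
  + by apply: contraNneq is_ => ->.
by rewrite IH// => j k js ks; apply: dF; rewrite inE ?js ?ks orbT.
Qed.

Lemma charge_ocitv (nu : borel_charge (R := R)) (x y : R) : (0 <= x)%R -> (x <= y)%R ->
  nu `[0%R, y]%classic = nu `[0%R, x]%classic + nu `]x, y]%classic.
Proof.
move=> x0 xy; rewrite -chargeU; try exact: measurable_itv.
  congr (nu _); apply/seteqP; split => t /=; rewrite !in_itv /=.
    by move=> /andP[-> ty] /=; have [tx|xt] := leP t x; [left|right; rewrite ty].
  by move=> [/andP[-> tx]|/andP[xt ->]] /=; [exact: le_trans tx xy|rewrite (le_trans x0 (ltW xt))].
apply/seteqP; split => // t /= [].
by rewrite !in_itv /= => /andP[_ tx] /andP[xt _]; move: (lt_le_trans xt tx); rewrite ltxx.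
Qed.

Variables (f : R -> R) (nu : borel_charge (R := R)).
Hypothesis hnu : is_mu f nu.

(** The half-open interval starts before [z] and its measure is a difference of
right limits of [mu_tilde]: superadditivity applies to the interval from [z] to
[y] without any control of [f] at the end points. *)
Lemma mu_lower (x z y L : R) : (0 <= x)%R -> (x < z)%R -> (z < y)%R -> (y < 1)%R ->
  (forall delta : R, (0 < delta)%R -> reaches f delta z y L) ->
  L%:E <= nu `]x, y]%classic.
Proof.
move=> x0 xz zy y1 hL; have [_ _ hmu _] := hnu.
have z0 : (0 < z)%R by exact: le_lt_trans x0 xz.
have y0 : (0 < y)%R by exact: lt_trans z0 zy.
have nux : nu `[0%R, x]%classic <= mu_tilde f `[0%R, z].
  have hx : (0 <= x < 1)%R by rewrite x0 (lt_trans xz (lt_trans zy y1)).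
  apply: (cvge_to_le (hmu x hx)); near=> t; apply: mu_tilde_mono => u.
  rewrite /= !in_itv /= => /andP[-> ut] /=; apply: le_trans ut _.
  by near: t; exact: nbhs_right_le.
have nuy : mu_tilde f `[0%R, y] <= nu `[0%R, y]%classic.
  have hy : (0 <= y < 1)%R by rewrite y1 ltW.
  apply: (cvge_to_ge (hmu y hy)); near=> t; apply: mu_tilde_mono => u.
  rewrite /= !in_itv /= => /andP[-> ut] /=; apply: le_trans ut _.
  by near: t; exact: nbhs_right_ge.
have := mu_tilde_superadditive z0 zy hL.
have := charge_ocitv nu x0 (ltW (lt_trans xz zy)).
have fx : nu `[0%R, x]%classic \is a fin_num by apply: fin_num_measure; exact: measurable_itv.
move=> E hz; have : nu `[0%R, x]%classic + L%:E <= nu `[0%R, x]%classic + nu `]x, y]%classic.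
  by rewrite -E; apply: le_trans nuy; apply: le_trans hz; rewrite leeD2r.
by rewrite leeD2lE.
Unshelve. all: by end_near. Qed.

(** Here [f] coincides with [h] even beyond [y], as the measure of the interval
involves the right limit of [mu_tilde] at [y]. *)
Lemma mu_null (h : R -> R) (x y r : R) : (0 <= x)%R -> (x < y)%R -> (y < r)%R -> (r <= 1)%R ->
  continuous f -> small_scale h -> (forall t, x <= t <= r -> f t = h t)%R ->
  nu `]x, y]%classic = 0.
Proof.
move=> x0 xy yr r1 cf hs fh; have [_ nu0 hmu _] := hnu.
have fx : nu `[0%R, x]%classic \is a fin_num by apply: fin_num_measure; exact: measurable_itv.
have mI : measurable (`]x, y]%classic : set (measurableTypeR R)) by exact: measurable_itv.
apply/le_anti/andP; split; last exact: nu0.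
rewrite -(@leeD2lE _ _ _ _ fx) adde0 -charge_ocitv// ?(ltW xy)//.
have hx : (0 <= x < 1)%R by rewrite x0 (lt_trans xy (lt_le_trans yr r1)).
have hy : (0 <= y < 1)%R by rewrite (le_trans x0 (ltW xy)) (lt_le_trans yr r1).
apply: (cvge_to_ge (hmu x hx)); near=> z.
have xz : (x < z)%R by near: z; exact: nbhs_right_gt.
have zy : (z < y)%R by near: z; exact: nbhs_right_lt.
apply: (cvge_to_le (hmu y hy)); near=> t.
have yt : (y < t)%R by near: t; exact: nbhs_right_gt.
have tr : (t < r)%R by near: t; exact: nbhs_right_lt.
apply: (@mu_tilde_stationary _ f h); [lra|lra|lra|exact: cf|exact: hs|].
by move=> u /andP[? ?]; apply: fh; apply/andP; split; lra.
Unshelve. all: by end_near. Qed.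

End Charges.

Section Branches.
Context {R : realType}.
Variables (a b c d : seq bool -> R) (g : seq bool -> R -> R).
Hypothesis hT : tree_family_of_trapezoids a b c d g.
Hypothesis hO : forall s, b (rcons s false) < a (rcons s true).
Implicit Types (sigma tau : nat -> bool).

Definition branch sigma (s : seq bool) : R := (s == mkseq sigma (size s))%:R.

Lemma branch_le1 sigma s : `|branch sigma s| <= 1.
Proof. by rewrite /branch; case: eqP => _; rewrite ?normr1// normr0. Qed.

Lemma branch_S2 sigma : (S2_norm (branch sigma) <= 1%:E)%E.
Proof.
apply: S2_norm_le => // l ul al; rewrite expr1n.
have : pairwise (fun s r => (branch sigma s == 0) || (branch sigma r == 0)) l.
  move: (ul); rewrite uniq_pairwise; apply: (@sub_in_pairwise _ (mem l)); last exact: allss.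
  move=> s r sl rl /= sr; apply: contraNT sr; rewrite negb_or /branch => /andP[].
  case: (s =P _) => [sE _|]; last by rewrite eqxx.
  case: (r =P _) => [rE _|]; last by rewrite eqxx.
  have pre n m : (n <= m)%N -> prefix (mkseq sigma n) (mkseq sigma m).
    by move=> nm; rewrite prefixE size_mkseq /mkseq -map_take take_iota (minn_idPl nm).
  have [sr|/ltnW rs] := leqP (size s) (size r).
    by apply/eqP; apply: al => //; rewrite sE rE pre.
  by apply/eqP/esym; apply: al => //; rewrite sE rE pre.
by case/pairwise_single => [[_ ->]//|[s _ [_ ->]]]; rewrite -real_normK ?num_real// expr_le1 ?branch_le1.
Qed.

Definition branch_fun sigma := embedding g (branch sigma).

Lemma branch_fun_continuous sigma : continuous (branch_fun sigma).
Proof. exact: (embedding_continuous hT hO (branch_le1 sigma)). Qed.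

Lemma branch_fun_V2 sigma : (V2_norm (branch_fun sigma) <= 4%:E)%E.
Proof. by have := embedding_V2_le hT hO (branch_S2 sigma); rewrite mulr1. Qed.

Lemma partial_branch_V2 sigma N : (V2_norm (partial g (branch sigma) N) <= 4%:E)%E.
Proof.
apply: V2_norm_le => // P [_ sP _]; rewrite -[X in X ^+ 2]mulr1.
apply: (upper_estimate hT hO) => // l ul al.
by apply: S2_norm_seq ul al; exact: branch_S2.
Qed.

Lemma branch_fun_bidual sigma : bidual (closed_span g) (branch_fun sigma).
Proof.
split.
  split; [by move=> t; exact: (embedding_out hT)|exact: (embedding0 hT)|].
  exact: le_lt_trans (branch_fun_V2 sigma) (ltry _).
exists (partial g (branch sigma)); split.
- by move=> N; exact: (partial_closed_span hT).
- by exists 4 => N; exact: partial_branch_V2.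
- by move=> t _; exact: (embedding_cvg hT hO (branch_le1 sigma)).
Qed.

Definition branch_bumps sigma n := [seq u <- bumps n | label u == mkseq sigma n].

Lemma mem_branch_bumps sigma n u : u \in branch_bumps sigma n =
  (label u == mkseq sigma n) && (u \in bumps n).
Proof. by rewrite mem_filter. Qed.

(** This is the computation of [sum_amplitude], started from [u] instead of the
root. *)
Lemma descendant_mass sigma n k u : u \in branch_bumps sigma n ->
  \sum_(v <- bumps (n + k) | label v == mkseq sigma (n + k))
    amplitude (n + k) ^+ 2 * (take n v == u)%:R = amplitude n ^+ 2 :> R.
Proof.
rewrite mem_branch_bumps => /andP[/eqP lu un]; elim: k => [|k IH].
  rewrite addn0 big_mkcond (bigD1_seq u) ?uniq_bumps//= lu eqxx.
  rewrite take_oversize ?(size_mem_bumps un)// eqxx mulr1.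
  rewrite big_seq_cond big1 ?addr0// => v /andP[vn vu].
  by rewrite take_oversize ?(size_mem_bumps vn)// (negbTE vu) mulr0; case: ifP.
rewrite addnS [mkseq _ _]mkseqS sum_bumpsS -[RHS]IH.
rewrite big_seq_cond [RHS]big_seq_cond; apply: eq_bigr => v /andP[vb _].
rewrite (eq_bigr (fun=> \sum_(sd : bool) amplitude (n + k).+1 ^+ 2 * (take n v == u)%:R)); last first.
  move=> i _; apply: eq_bigr => sd _.
  by rewrite -cats1 takel_cat// (size_mem_bumps vb) leq_addr.
rewrite sumr_const card_ord sumr_const card_bool -mulrnA -[LHS]mulr_natr natrM.
by rewrite -[in RHS](amplitudeS_sqr (n + k)); ring.
Qed.

(** The bumps of a late level above [u] carry together the mass of [u].  Those not
shorter than [delta] are disjoint subintervals of the unit interval, so their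
number is bounded independently of the level and their mass is negligible. *)
Lemma branch_fun_reaches sigma n u delta : u \in branch_bumps sigma n -> 0 < delta ->
  reaches (branch_fun sigma) delta (c (node u)) (d (node u)) (amplitude n ^+ 2 / 2).
Proof.
move=> un d0; have [l1 l2 l3 l4] := tree_lt hT (node u).
have [t0 _ _ _ t1] := tree_nodeP hT (node u).
(* [e] is chosen so that [2 / delta ^ 2] bumps of amplitude at most [e] carry at
most half of the mass of [u]. *)
pose e : R := Num.sqrt (amplitude n ^+ 2 * delta ^+ 2 / 4).
have e2 : e ^+ 2 = amplitude n ^+ 2 * delta ^+ 2 / 4.
  by rewrite sqr_sqrtr// divr_ge0// mulr_ge0// sqr_ge0.
have e0 : 0 < e by rewrite sqrtr_gt0 divr_gt0// mulr_gt0// exprn_gt0// amplitude_gt0.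
have [m /(_ (n + m.+1)%N)] := amplitude_small e0.
rewrite addnS => /(_ (leqW (leq_addl _ _))); rewrite -addnS; set M := (n + m.+1)%N => Me.
pose D := [seq v <- branch_bumps sigma M | take n v == u].
pose short v := top c v - a (node v) < delta.
have DP v : v \in D -> [/\ v \in bumps (size v), label v = mkseq sigma M, size v = M,
    c (node u) <= a (node v) & top c v <= d (node u)].
  rewrite mem_filter mem_branch_bumps => /and3P[/eqP tv /eqP lv vb].
  have sv := size_mem_bumps vb.
  have nz : drop n v != [::] by rewrite -size_eq0 size_drop sv /M addKn.
  have vE : u ++ drop n v = v by rewrite -tv cat_take_drop.
  have := @node_sdesc _ _ _ _ _ _ hT u _ nz; rewrite vE => -[h1 h2].
  have /andP[_ ?] := top_in hT v; have [_ _ ? _] := tree_lt hT (node v).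
  by split => //; [rewrite sv|lra].
have uD : uniq D by rewrite filter_uniq// filter_uniq// uniq_bumps.
have disjD : {in D &, forall v w, v != w -> top c v < a (node w) \/ top c w < a (node v)}.
  move=> v w /DP[_ lv sv _ _] /DP[_ lw sw _ _] vw.
  by apply: (foot_top_disjoint hT hO) => //; rewrite lv lw.
have massD : \sum_(v <- D) amplitude M ^+ 2 = amplitude n ^+ 2 :> R.
  rewrite -(descendant_mass m.+1 un) /D /branch_bumps big_filter big_filter_cond.
  rewrite [RHS]big_mkcond [LHS]big_mkcond; apply: eq_bigr => v _ /=.
  by rewrite -/M; case: (label v == _); case: (take n v == u); rewrite ?mulr1 ?mulr0.
(* The identity has quadratic variation at most 2 along a partition of mesh less
than 2, which bounds the number of the long bumps. *)
have long : \sum_(v <- [seq v <- D | ~~ short v]) delta ^+ 2 <= 2.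
  have hR : reaches id 2 0 1 (\sum_(v <- [seq v <- D | ~~ short v])
      (top c v - a (node v)) ^+ 2).
    apply: (reaches_disjoint (p := fun v => a (node v)) (q := fun v => top c v) id) => //.
    - move=> v; rewrite mem_filter => /andP[_ /DP[_ _ _ h1 h2]].
      have /andP[? ?] := top_in hT v; have [? _ _ _] := tree_lt hT (node v).
      by split; lra.
    - by rewrite filter_uniq.
    - move=> v w; rewrite mem_filter => /andP[_ vD]; rewrite mem_filter => /andP[_ wD].
      exact: disjD.
  have [|P [PI Pm hP]] := reaches_partition (I := `[0, 1]%classic) ltr01 _ hR.
    by move=> t; rewrite /= in_itv.
  apply: (@le_trans _ _ (qv id P)).
    apply: le_trans hP; rewrite big_seq [leRHS]big_seq; apply: ler_sum => v.
    rewrite mem_filter /short -leNgt => /andP[hv _].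
    by rewrite ler_sqr ?nnegrE ?(ltW d0)// (le_trans (ltW d0)).
  have := @qv_lipschitz _ id 1 P ler01; rewrite expr1n mul1r => H.
  by apply: le_trans (H _ PI) (ltW Pm) => s t; rewrite mul1r.
have := @embedding_reaches _ _ _ _ _ _ hT hO [seq v <- D | short v] (branch sigma) 1 delta
  (c (node u)) (d (node u)) (branch_le1 sigma) d0 (ltW l2).
rewrite filter_uniq// => /(_ isT) H; apply: reaches_le (H _ _ _).
- rewrite (eq_big_seq (fun=> amplitude M ^+ 2)); last first.
    move=> v; rewrite mem_filter => /andP[_ /DP[_ lv sv _ _]].
    by rewrite sv /branch lv size_mkseq eqxx expr1n mulr1.
  have := massD; rewrite (bigID short) /= -[X in X + _]big_filter -[X in _ + X]big_filter => massE.
  have : \sum_(v <- [seq v <- D | ~~ short v]) amplitude M ^+ 2 <= amplitude n ^+ 2 / 2 :> R; last by lra.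
  have AM : amplitude M ^+ 2 <= amplitude n ^+ 2 / 4 * delta ^+ 2.
    apply: (@le_trans _ _ (e ^+ 2)); first by rewrite ler_sqr ?nnegrE ?amplitude_ge0 ?(ltW e0).
    by rewrite e2; lra.
  apply: (@le_trans _ _ (\sum_(v <- [seq v <- D | ~~ short v]) amplitude n ^+ 2 / 4 * delta ^+ 2)).
    by apply: ler_sum => v _.
  rewrite -mulr_sumr; have A0 : 0 <= amplitude n ^+ 2 / 4 :> R by rewrite divr_ge0// sqr_ge0.
  by have := ler_wpM2l A0 long; lra.
- move=> _ _ /mapP[v + ->] /mapP[w + ->]; rewrite mem_filter => /andP[_ /DP[_ -> _ _ _]].
  by rewrite mem_filter => /andP[_ /DP[_ -> _ _ _]].
- by move=> v; rewrite mem_filter => /andP[_ /DP[]].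
- by move=> v; rewrite mem_filter => /andP[hv /DP[]]; split.
Qed.

(** Beyond level [n] the bumps of [tau] lie above bumps of level [n] other than
[u], and these are disjoint from [u]. *)
Lemma branch_fun_off sigma tau n u t : mkseq sigma n != mkseq tau n ->
  u \in branch_bumps sigma n -> a (node u) <= t <= b (node u) ->
  branch_fun tau t = partial g (branch tau) n t.
Proof.
move=> st; rewrite mem_branch_bumps => /andP[/eqP lu un] /andP[t1 t2].
apply: cvg_lim => //; apply: cvg_near_cst; near=> N.
have nN : (n <= N)%N by near: N; exact: nbhs_infty_ge.
rewrite /partial (@big_cat_nat _ _ _ n 0 N)//= [X in _ + X]big_nat_cond.
rewrite [X in _ + X]big1 ?addr0// => m /andP[/andP[nm _] _]; rewrite /level big_seq big1 ?mulr0// => v vm.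
have [/eqP tv|tv] := boolP (take n v == u).
  rewrite /branch; case: eqP => [lv|_]; last by rewrite mul0r.
  move: st; rewrite -lu -tv label_take lv size_label (size_mem_bumps vm).
  by rewrite /mkseq -map_take take_iota (minn_idPl nm) eqxx.
rewrite (phi_out hT) ?mulr0//.
have := node_desc hT (take n v) (drop n v); rewrite cat_take_drop => -[h1 h2].
have sv : size (take n v) = size u.
  by rewrite (size_mem_bumps un); apply: size_takel; rewrite (size_mem_bumps vm).
by have [?|?] := node_disjoint hT hO sv tv; [right|left]; lra.
Unshelve. all: by end_near. Qed.

(** The separating set is the union of the intervals from the left end of the foot
to the right end of the first plateau of the bumps of [sigma] at level [n]: they
stop before the right end of the bump, which leaves to the function of [tau] a
neighbourhood where it is a finite sum, and contain all the later bumps above it. *)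
Lemma branch_measures_separated sigma tau n nu rho : mkseq sigma n != mkseq tau n ->
  is_mu (branch_fun sigma) nu -> is_mu (branch_fun tau) rho ->
  ((2^-1)%:E <= M01_dist nu rho)%E.
Proof.
move=> st hnu hrho.
(* At level 0 the only bump may touch the ends of the unit interval. *)
have n0 : (0 < n)%N by case: n st.
pose F u : set (measurableTypeR R) := `]a (node u), d (node u)]%classic.
have mF u : measurable (F u) by exact: measurable_itv.
pose L := branch_bumps sigma n.
have uL : uniq L by rewrite filter_uniq// uniq_bumps.
have dF : {in L &, forall u v, u != v -> F u `&` F v = set0}.
  move=> u v; rewrite !mem_branch_bumps => /andP[_ ub] /andP[_ vb] uv.
  have suv : size u = size v by rewrite (size_mem_bumps ub) (size_mem_bumps vb).
  have [l1 l2 l3 l4] := tree_lt hT (node u); have [m1 m2 m3 m4] := tree_lt hT (node v).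
  apply: (@ocitv_disjoint R (a (node u)) (d (node u)) (a (node v)) (d (node v))).
  by have [?|?] := node_disjoint hT hO suv uv; [left|right]; lra.
have strict u : u \in L -> 0 < a (node u) /\ b (node u) < 1.
  rewrite mem_branch_bumps => /andP[_ /size_mem_bumps su].
  have := @node_sdesc _ _ _ _ _ _ hT [::] u; case: u su => [su|e u _].
    by rewrite -su in n0.
  move=> /(_ isT); rewrite cat0s => -[h1 h2].
  by have [? ? ? ? ?] := tree_nodeP hT (node [::]); split; lra.
apply: ereal_sup_ge; exists (`|nu (\big[setU/set0]_(u <- L) F u) - rho (\big[setU/set0]_(u <- L) F u)|)%E.
  exists (\big[setU/set0]_(u <- L) F u) => //; split; first exact: bigsetU_measurable.
  rewrite -bigcup_seq => t [u /= uL']; rewrite /F /= !in_itv /= => /andP[? ?].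
  by have [? ? ? ? ?] := tree_nodeP hT (node u); apply/andP; split; lra.
rewrite !charge_disjoint_sum// [X in (_ - X)%E]big1_seq ?sube0; last first.
  move=> u /andP[_ uin]; have [s1 s2] := strict u uin; have [l1 l2 l3 l4] := tree_lt hT (node u).
  apply: (mu_null hrho (h := partial g (branch tau) n) (r := b (node u))); [lra|lra|lra|lra| | |].
  - exact: branch_fun_continuous.
  - by have /V20P[] := partial_V20 hT (branch tau) n.
  - by move=> t ht; exact: branch_fun_off st uin ht.
apply: le_trans (lee_abs _).
apply: (@le_trans _ _ (\sum_(u <- L) (amplitude n ^+ 2 / 2)%:E)%E).
  rewrite sumEFin lee_fin -mulr_suml /L big_filter.
  by have := sum_amplitude (R := R) (mkseq sigma n); rewrite size_mkseq => ->; rewrite mul1r.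
rewrite big_seq [leRHS]big_seq; apply: lee_sum => u uin.
have [s1 s2] := strict u uin; have [l1 l2 l3 l4] := tree_lt hT (node u).
apply: (mu_lower hnu (z := c (node u))); [lra|lra|lra|lra|].
by move=> delta d0; exact: branch_fun_reaches.
Qed.

End Branches.

Section NonSeparability.
Context {R : realType}.

(** Cantor's diagonal argument. *)
Lemma no_injection_to_nat (i : (nat -> bool) -> nat) : ~ injective i.
Proof.
move=> inji; pose del n := `[< exists2 sigma, i sigma = n & sigma n = false >].
have [/asboolP[sigma /inji -> h]|/negP] := boolP (del (i del)).
  suff : del (i del) by rewrite h.
  by apply/asboolP; exists del.
by move=> h; apply: (h); apply/asboolP; exists del => //; exact/negbTE/negP.
Qed.

Lemma M01_dist_triangle (nu rho theta : borel_charge (R := R)) :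
  (M01_dist nu rho <= M01_dist nu theta + M01_dist rho theta)%E.
Proof.
apply: ge_ereal_sup => _ [B [mB B01] <-].
have fin (x : borel_charge (R := R)) : x B \is a fin_num by exact: fin_num_measure.
apply: (@le_trans _ _ (`|nu B - theta B| + `|rho B - theta B|)%E).
  rewrite -(fineK (fin nu)) -(fineK (fin rho)) -(fineK (fin theta)) -!EFinB !abse_EFin -EFinD lee_fin.
  set x := fine _; set y := fine _; set z := fine _.
  have -> : x - y = (x - z) - (y - z) by ring.
  exact: ler_normB.
by apply: leeD; apply: ereal_sup_ubound; exists B.
Qed.

Lemma separated_not_separable (A : set (borel_charge (R := R)))
    (nu : (nat -> bool) -> borel_charge) (e : R) : 0 < e ->
  (forall sigma, A (nu sigma)) ->
  (forall sigma tau, sigma <> tau -> (e%:E <= M01_dist (nu sigma) (nu tau))%E) ->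
  ~ M01_separable A.
Proof.
move=> e0 An sep [D [/countable_injP[i inji] _ dense]].
have /choice[rho hrho] : forall sigma, exists rho, D rho /\ (M01_dist (nu sigma) rho < (e / 2)%:E)%E.
  by move=> sigma; have [rho Dr h] := dense _ (An sigma) _ (divr_gt0 e0 (ltr0Sn _ 1)); exists rho.
apply: (@no_injection_to_nat (i \o rho)) => sigma tau /= E.
have [Ds hs] := hrho sigma; have [Dt ht] := hrho tau.
apply: contrapT => /sep; apply/negP; rewrite -ltNge.
apply: le_lt_trans (M01_dist_triangle _ _ (rho sigma)) _.
have -> : e%:E = ((e / 2)%:E + (e / 2)%:E)%E by rewrite -EFinD; congr EFin; field.
apply: lteD => //; suff -> : rho sigma = rho tau by [].
by apply: inji => //; rewrite inE.
Qed.

Theorem ordered_not_separable (a b c d : seq bool -> R) (g : seq bool -> R -> R)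
    (X : set (R -> R)) : tree_family_of_trapezoids a b c d g ->
  (forall s, b (rcons s false) < a (rcons s true)) ->
  closed_span g `<=` X -> ~ M01_separable (Mc X).
Proof.
move=> hT hO gX.
have /choice[nu hnu] : forall sigma, exists nu, is_mu (branch_fun g sigma) nu.
  by move=> sigma; exact: is_mu_exists (branch_fun_V2 hT hO sigma).
apply: (@separated_not_separable _ nu 2^-1); first by rewrite invr_gt0.
- move=> sigma; exists (branch_fun g sigma); split => //.
  + have [V2f [u [uX uM uf]]] := branch_fun_bidual hT hO sigma.
    by split => //; exists u; split => // n; exact: gX.
  + exact/continuous_subspaceT/(branch_fun_continuous hT hO).
- move=> sigma tau st; have [k hk] : exists k, sigma k != tau k.
    apply: contrapT => no; apply: st; apply/funext => k; apply/eqP/negPn/negP => h.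
    by apply: no; exists k.
  apply: (branch_measures_separated hT hO (n := k.+1) _ (hnu sigma) (hnu tau)).
  apply: contra hk => /eqP /(congr1 (fun s => nth false s k)).
  by rewrite !nth_mkseq// => ->.
Qed.

End NonSeparability.

(** * Orientation of the tree *)

Section Orientation.
Context {R : realType}.
Variables (a b c d : seq bool -> R) (g : seq bool -> R -> R).
Hypothesis hT : tree_family_of_trapezoids a b c d g.

Definition crossed (s : seq bool) : bool := b (rcons s true) < a (rcons s false).

(** Along the image of a word, the bit is flipped wherever the two successors of
the node reached are crossed. *)
Definition orient : seq bool -> seq bool :=
  foldl (fun r i => rcons r (i (+) crossed r)) [::].

Lemma orient_rcons s i : orient (rcons s i) = rcons (orient s) (i (+) crossed (orient s)).
Proof. by rewrite /orient foldl_rcons. Qed.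

Lemma orient_tree : tree_family_of_trapezoids (a \o orient) (b \o orient) (c \o orient)
  (d \o orient) (g \o orient).
Proof.
move=> s; have [h1 h2 h3 h4] := hT (orient s); split => //.
  by move=> i /=; rewrite orient_rcons; exact: h3.
by rewrite /= !orient_rcons; case: crossed => //=; rewrite setIC.
Qed.

Lemma orient_ordered s : (b \o orient) (rcons s false) < (a \o orient) (rcons s true).
Proof.
rewrite /= !orient_rcons; set o := orient s; have [//|] := boolP (crossed o).
rewrite /crossed -leNgt /= => FT; rewrite ltNge; apply/negP => TF.
have [_ _ _ disj] := hT o.
have [_ _ _ l] := tree_lt hT (rcons o false); have [_ _ _ m] := tree_lt hT (rcons o true).
pose t := Num.max (a (rcons o false)) (a (rcons o true)).
have : (`[a (rcons o false), b (rcons o false)] `&`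
        `[a (rcons o true), b (rcons o true)]) t; last by rewrite disj.
by split; rewrite /= in_itv /= /t le_max lexx ?orbT /= ge_max ?FT ?TF ?(ltW l) ?(ltW m).
Qed.

Lemma orient_closed_span : closed_span (g \o orient) `<=` closed_span g.
Proof.
move=> f [V20f fg]; split => // e e0; have [h [s [k hE]] he] := fg e e0.
by exists h => //; rewrite hE; exact: linear_span_sum.
Qed.

End Orientation.

Theorem proposition50 (R : realType) (a b c d : seq bool -> R)
    (g : seq bool -> R -> R)
    (hg : tree_family_of_trapezoids a b c d g) :
  ~ M01_separable (Mc (closed_span g)) /\
  S2_isomorphic_to_subspace_of (closed_span g).
Proof.
have hT := orient_tree hg; have hO := orient_ordered hg; split.
  exact: ordered_not_separable hT hO (@orient_closed_span _ a b g).
have [T [TX Tlin Tiso]] := S2_embedding hT hO.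
by exists T; split => // x /TX; exact: orient_closed_span.
Qed.
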